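(* Let $n\ge 3$, $1\le k\le n-1$, and let $F_1$ be a Minkowski norm on $\mathbb{R}^n$ invariant under the standard block diagonal action of $SO(k)\times SO(n-k)$, with Hessian metric $g_1$. Let $V'=\mathrm{span}(e_1,\dots,e_k)$, $V''=\mathrm{span}(e_{k+1},\dots,e_n)$. Let $C(U_1)\subset\mathbb{R}^n\setminus\{0\}$ be a connected $SO(k)\times SO(n-k)$-invariant conic open set such that $g_1|_y(v',v'')=0$ for all $y\in C(U_1)$, $v'\in V'$, $v''\in V''$. Then $F_1$ is Euclidean on $C(U_1)$, i.e. there is a positive definite symmetric matrix $(\alpha_{ij})$ with $F_1(x)=\sqrt{\sum\alpha_{ij}x_ix_j}$ for all $x\in C(U_1)$. Moreover, for any Minkowski norm $F_2$ invariant under the same action and any local Hessian isometry $\Phi$ from $F_1$ to $F_2$ defined on $C(U_1)$ which maps $SO(k)\times SO(n-k)$-orbits into $SO(k)\times SO(n-k)$-orbits, $\Phi$ is the restriction to $C(U_1)$ of an invertible linear map, and $F_2$ restricted to $C(U_2)=\Phi(C(U_1))$ is Euclidean (coincides there with the square root of a positive definite quadratic form).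
   Context: A Minkowski norm on $\mathbb{R}^n$ is a continuous function $F:\mathbb{R}^n\to\mathbb{R}_{\ge 0}$, smooth and positive on $\mathbb{R}^n\setminus\{0\}$, positively $1$-homogeneous, such that the Hessian of $E=\tfrac12F^2$ is positive definite on $\mathbb{R}^n\setminus\{0\}$; its Hessian metric is $g=\mathrm{d}^2E$. The standard block diagonal action of $SO(k)\times SO(n-k)$ is left multiplication by $\mathrm{diag}(A',A'')$, $A'\in SO(k)$, $A''\in SO(n-k)$. A conic set is one of the form $\{\lambda y\mid y\in U,\lambda>0\}$. A local Hessian isometry from $F_1$ to $F_2$ defined on a conic open set $C(U_1)$ is a positively $1$-homogeneous diffeomorphism $\Phi:C(U_1)\to C(U_2)$ onto a conic open set with $\Phi^*g_2=g_1$. *)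

(* Defs.v *)
From HB Require Import structures.
From mathcomp Require Import all_boot all_order all_algebra.
From mathcomp Require Import all_classical all_reals all_analysis.
Set Implicit Arguments. Unset Strict Implicit. Unset Printing Implicit Defensive.
Import Order.TTheory GRing.Theory Num.Theory.
Import numFieldNormedType.Exports.
Local Open Scope classical_set_scope.
Local Open Scope ring_scope.

Section Defs.
Variable R : realType.

Definition ebase (n : nat) (i : 'I_n) : 'rV[R]_n := delta_mx 0 i.

Definition partial (n : nat) (i : 'I_n) (f : 'rV[R]_n -> R) : 'rV[R]_n -> R :=
  fun x => 'D_(ebase i) f x.

Definition iter_partial (n : nat) (l : seq 'I_n) (f : 'rV[R]_n -> R) :=
  foldr (fun i g => partial i g) f l.

Definition smooth_on (n : nat) (U : set 'rV[R]_n) (f : 'rV[R]_n -> R) : Prop :=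
  forall (l : seq 'I_n) (x : 'rV[R]_n), U x ->
    {for x, continuous (iter_partial l f)} /\
    forall i : 'I_n, derivable (iter_partial l f) x (ebase i).

Definition smooth_map_on (n : nat) (U : set 'rV[R]_n)
  (Phi : 'rV[R]_n -> 'rV[R]_n) : Prop :=
  forall j : 'I_n, smooth_on U (fun x => Phi x ord0 j).

Definition hessian (n : nat) (f : 'rV[R]_n -> R) (y : 'rV[R]_n) : 'M[R]_n :=
  \matrix_(i, j) partial i (partial j f) y.

Definition bform (n : nat) (M : 'M[R]_n) (u v : 'rV[R]_n) : R :=
  (u *m M *m v^T) ord0 ord0.

Definition posdef (n : nat) (M : 'M[R]_n) : Prop :=
  forall v : 'rV[R]_n, v != 0 -> 0 < bform M v v.

Definition symmetric_mx (n : nat) (M : 'M[R]_n) : Prop := M^T = M.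

Definition energy (n : nat) (F : 'rV[R]_n -> R) : 'rV[R]_n -> R :=
  fun x => F x ^+ 2 / 2.

Definition hess_metric (n : nat) (F : 'rV[R]_n -> R) (y u v : 'rV[R]_n) : R :=
  bform (hessian (energy F) y) u v.

Definition minkowski_norm (n : nat) (F : 'rV[R]_n -> R) : Prop :=
  continuous F /\
  (forall x, 0 <= F x) /\
  smooth_on (~` [set 0]) F /\
  (forall x, x != 0 -> 0 < F x) /\
  (forall (t : R) x, 0 < t -> F (t *: x) = t * F x) /\
  (forall y, y != 0 -> posdef (hessian (energy F) y)).

Definition SO_mx (p : nat) (A : 'M[R]_p) : Prop :=
  A *m A^T = 1%:M /\ \det A = 1.

(* block diagonal action of SO(k) x SO(m) on R^(k+m): y |-> diag(A',A'') y *)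
Definition bact (k m : nat) (A' : 'M[R]_k) (A'' : 'M[R]_m) (y : 'rV[R]_(k + m))
  : 'rV[R]_(k + m) :=
  y *m (block_mx A' 0 0 A'')^T.

Definition block_invariant_fun (k m : nat) (F : 'rV[R]_(k + m) -> R) : Prop :=
  forall A' A'' y, SO_mx A' -> SO_mx A'' -> F (bact A' A'' y) = F y.

Definition block_invariant_set (k m : nat) (C : set 'rV[R]_(k + m)) : Prop :=
  forall A' A'' y, SO_mx A' -> SO_mx A'' -> C y -> C (bact A' A'' y).

Definition conic (n : nat) (C : set 'rV[R]_n) : Prop :=
  exists U : set 'rV[R]_n,
    C = [set z | exists y t, U y /\ 0 < t /\ z = t *: y].

Definition euclidean_on (n : nat) (F : 'rV[R]_n -> R) (C : set 'rV[R]_n) : Prop :=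
  exists alpha : 'M[R]_n, symmetric_mx alpha /\ posdef alpha /\
    forall x, C x -> F x = Num.sqrt (bform alpha x x).

Definition local_hessian_isometry (n : nat) (F1 F2 : 'rV[R]_n -> R)
  (C1 : set 'rV[R]_n) (Phi : 'rV[R]_n -> 'rV[R]_n) : Prop :=
  exists C2 : set 'rV[R]_n,
    conic C2 /\ open C2 /\
    (forall y, C1 y -> C2 (Phi y)) /\
    (exists Psi : 'rV[R]_n -> 'rV[R]_n,
        (forall z, C2 z -> C1 (Psi z)) /\
        (forall y, C1 y -> Psi (Phi y) = y) /\
        (forall z, C2 z -> Phi (Psi z) = z) /\
        smooth_map_on C1 Phi /\ smooth_map_on C2 Psi) /\
    (forall (t : R) y, 0 < t -> C1 y -> Phi (t *: y) = t *: Phi y) /\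
    (forall y u v, C1 y ->
       hess_metric F2 (Phi y) ('D_u Phi y) ('D_v Phi y) = hess_metric F1 y u v).

Definition maps_orbits (k m : nat) (C : set 'rV[R]_(k + m))
  (Phi : 'rV[R]_(k + m) -> 'rV[R]_(k + m)) : Prop :=
  forall y A' A'', C y -> SO_mx A' -> SO_mx A'' ->
    exists B' B'', SO_mx B' /\ SO_mx B'' /\
      Phi (bact A' A'' y) = bact B' B'' (Phi y).

End Defs.

(* Main.v *)
Require Import Defs.
From HB Require Import structures.
From mathcomp Require Import all_boot all_order all_algebra.
From mathcomp Require Import ring lra zify.
From mathcomp Require Import all_classical all_reals all_analysis.
Set Implicit Arguments. Unset Strict Implicit. Unset Printing Implicit Defensive.
Import Order.TTheory GRing.Theory Num.Theory.
Import numFieldNormedType.Exports.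
Local Open Scope classical_set_scope.
Local Open Scope ring_scope.

(** On [C1] the identities [x_i E_j = x_j E_i] (rotation invariance), Euler's
    relation and the block orthogonality make the Hessian of [E = F1^2/2]
    diagonal with [E_l = x_l E_ll], so all third derivatives vanish and the
    Hessian is the constant form [sum_b c_b |.|_b^2].

    For a Hessian isometry [Z = Phi] put [P = grad E2 (Z)]; invariance of [F2]
    gives [P = a_b Z] on the block [b], where the slope [a_b] is constant on
    orbits, and the isometry equation reads [sum_i D_u P_i D_v Z_i = g1(u, v)].
    [D Phi] maps orbit tangents onto orbit tangents, hence radial directions to
    radial ones: [D_(x_e) Z = n_b Z] on the block [b]. Differentiating the
    isometry equation along [x_e] shows that [G_b = D_(x_e) a_b + 2 a_b n_b] is
    [0] or [2 a_b] when [b] has at least two coordinates. If the other block is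
    one-dimensional, an orbit is a round sphere: its great circles are mapped to
    solutions of [z'' = - l^2 z] of period [2 pi], so [l >= 1], which yields
    [0 <= G_b <= 2 a_b] for that block. In all cases the Euler relations
    [sum_b f_b G_b = 2 sum_b f_b n_b (G_b - a_b n_b)] with [f_b = |Z_b|^2] then
    force [D_(x_e) a_b = 0]. So the slopes are locally constant, [Phi] is an
    isometry between constant metrics, and its second derivatives vanish. *)

(** * Differential calculus on row vectors *)

(** The target Hessian is not assumed block-orthogonal. In the coordinates (Z, P) the pulled-back
    metric is sum_i dP_i dZ_i, which is first order and, once P = a_b Z on each block, involves only
    Z and two scalar functions. The difficulty is the behaviour of the slopes in the two radial
    directions, where invariance says nothing. The Euler relations can be rewritten as the vanishing
    of the sum of f_b ((2 a_b n_b - G_b)^2 + G_b (2 a_b - G_b)) / (4 a_b), and 0 <= G_b <= 2 a_b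
    makes each term nonnegative. Hence G_b = 2 a_b n_b, which is the constancy of a_b. A
    one-dimensional block has no tangent vectors, so differentiating the metric tells nothing about
    its G_b. Here l^2 = c_b |x_b|^2 / A_b with A_b = a_b f_b for the round block, so l >= 1 bounds
    A_b, and the sum rules for A and G carry the bound over to the one-dimensional block. Divisions
    by |x_b|^2 and |Z_b|^2 confine the argument to [generic] points; these are dense, and continuity
    of the second derivatives of [Phi] covers the rest. *)

Section Calculus.
Variable R : realType.

Lemma continuous_sum_at (T : topologicalType) (I : Type) (r : seq I)
    (F : I -> T -> R) (x : T) :
  (forall i, {for x, continuous (F i)}) ->
  {for x, continuous (fun y => \sum_(i <- r) F i y)}.
Proof.
move=> cF; rewrite /prop_for /continuous_at; elim: r => [|i r IH].
  by under eq_fun do rewrite big_nil; rewrite big_nil; exact: cvg_cst.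
under eq_fun do rewrite big_cons.
by rewrite big_cons; apply: cvgD; [exact: cF|exact: IH].
Qed.

Lemma is_derive_line n (f : 'rV[R]_n -> R) (x v : 'rV[R]_n) (s : R) :
  derivable f (x + s *: v) v ->
  is_derive s (1 : R) (fun r => f (x + r *: v)) ('D_v f (x + s *: v)).
Proof.
have E : (fun h : R => h^-1 *: (((fun r => f (x + r *: v)) \o shift s) (h *: 1)
     - f (x + s *: v))) =
    (fun h : R => h^-1 *: ((f \o shift (x + s *: v)) (h *: v) - f (x + s *: v))).
  apply/funext => h /=; congr (_ *: (f _ - _)).
  by rewrite [h *: 1]mulr1 scalerDl addrCA.
by move=> df; split; rewrite /derivable /derive E.
Qed.

Lemma line_mvt n (f : 'rV[R]_n -> R) (x v : 'rV[R]_n) (t : R) :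
  (forall s, `|s| <= `|t| -> derivable f (x + s *: v) v) ->
  exists2 s, `|s| <= `|t| & f (x + t *: v) - f x = t * 'D_v f (x + s *: v).
Proof.
move=> df; pose g r := f (x + r *: v).
have dg s : `|s| <= `|t| -> is_derive s (1 : R) g ('D_v f (x + s *: v)).
  by move=> st; apply: is_derive_line; exact: df.
have cg a b : (forall s, s \in `[a, b]%R -> `|s| <= `|t|) -> {within `[a, b], continuous g}.
  move=> ab; apply: derivable_within_continuous => s sab.
  by have [] := dg s (ab s sab).
have g0 : g 0 = f x by rewrite /g scale0r addr0.
have [t0|t0] := lerP 0 t.
  have H s : s \in `[0, t]%R -> `|s| <= `|t|.
    by rewrite in_itv /= => /andP[s0 st]; rewrite !ger0_norm.
  have [|c cI] := @MVT_segment _ g (fun s => 'D_v f (x + s *: v)) _ _ t0 _ (cg 0 t H).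
    by move=> s sI; apply: dg; apply: H; exact: subset_itv_oo_cc.
  by rewrite subr0 g0 => E; exists c; [exact: H|rewrite [LHS]E mulrC].
have H s : s \in `[t, 0]%R -> `|s| <= `|t|.
  by rewrite in_itv /= => /andP[s0 st]; rewrite !ler0_norm ?(ltW t0)// lerN2.
have [|c cI] := @MVT_segment _ g (fun s => 'D_v f (x + s *: v)) _ _ (ltW t0) _ (cg t 0 H).
  by move=> s sI; apply: dg; apply: H; exact: subset_itv_oo_cc.
rewrite sub0r g0 => E; exists c; first exact: H.
by rewrite -[LHS]opprB E mulrN opprK mulrC.
Qed.

Lemma open_norm_ball n (U : set 'rV[R]_n) x : open U -> U x ->
  exists2 d : R, 0 < d & forall h, `|h| < d -> U (x + h).
Proof.
move=> oU Ux; have /nbhs_ballP[d /= d0 H] := open_nbhs_nbhs (conj oU Ux).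
by exists d => // h hd; apply: H; rewrite -ball_normE /= opprD addNKr normrN.
Qed.

Lemma continuous_norm_ball n (f : 'rV[R]_n -> R) x : {for x, continuous f} ->
  forall e : R, 0 < e -> exists2 d : R, 0 < d &
    forall h, `|h| < d -> `|f (x + h) - f x| < e.
Proof.
move=> /cvgrPdist_lt cf e e0; have /nbhs_ballP[d /= d0 H] := cf e e0.
exists d => // h hd; rewrite distrC; apply: H.
by rewrite -ball_normE /= opprD addNKr normrN.
Qed.

Lemma norm_coord_le n (h : 'rV[R]_n) i : `|h 0 i| <= `|h|.
Proof.
by rewrite [leRHS]/Num.Def.normr/= mx_normrE; exact: (le_bigmax _ _ (0, i)).
Qed.

Lemma norm_row_le n (h : 'rV[R]_n) (e : R) : 0 <= e ->
  (forall i, `|h 0 i| <= e) -> `|h| <= e.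
Proof.
move=> e0 H; rewrite /Num.Def.normr/= mx_normrE; apply: bigmax_le => // -[i j] _.
by rewrite /= (ord1 i).
Qed.

Lemma near0_norm_lt n (d : R) : 0 < d -> \forall h \near (0 : 'rV[R]_n), `|h| < d.
Proof.
move=> d0; apply/nbhs_ballP; exists d => // h.
by rewrite -ball_normE /= sub0r normrN.
Qed.

Lemma norm_ebase_le n (i : 'I_n) : `|ebase R i| <= 1.
Proof.
apply: norm_row_le => // j; rewrite mxE; case: (_ && _) => //=.
  by rewrite normr1.
by rewrite normr0.
Qed.

Definition gradform n (f : 'rV[R]_n -> R) (x h : 'rV[R]_n) : R :=
  \sum_i h 0 i * partial i f x.

Lemma gradform_linear n (f : 'rV[R]_n -> R) x : linear (gradform f x).
Proof.
move=> a u v; rewrite /gradform scaler_sumr -big_split /=; apply: eq_bigr => i _.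
by rewrite !mxE mulrDl -mulrA.
Qed.

HB.instance Definition _ n (f : 'rV[R]_n -> R) x :=
  GRing.isLinear.Build R 'rV[R]_n R *:%R (gradform f x)
    (gradform_linear f x).

(** The points [truncate i h] form a staircase from 0 to [h] with edges parallel to the axes, so
    each increment of f is governed by one partial derivative. *)
Definition truncate n (k : nat) (h : 'rV[R]_n) : 'rV[R]_n :=
  \row_i (if (i < k)%N then h 0 i else 0).

Lemma truncateS n (i : 'I_n) (h : 'rV[R]_n) :
  truncate i.+1 h = truncate i h + h 0 i *: ebase R i.
Proof.
apply/rowP => j; rewrite !mxE ltnS /=.
have [->|ji] := eqVneq j i; first by rewrite leqnn ltnn mulr1 add0r.
rewrite mulr0 addr0 leq_eqVlt; case: eqP => // /ord_inj E.
by rewrite E eqxx in ji.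
Qed.

Lemma differentiable_estimate (V W : normedModType R) (f : V -> W)
    (df : {linear V -> W}) (x : V) : continuous df ->
  (forall e : R, 0 < e ->
     \forall h \near 0, `|f (h + x) - (f x + df h)| <= e * `|h|) ->
  differentiable f x /\ 'd f x = df :> (V -> W).
Proof.
move=> cdf H.
have E : f \o shift x = cst (f x) + df +o_ 0 id by apply/eqaddoP => e /H.
have D : 'd f x = df :> (V -> W) by exact: diff_unique.
by split => //; apply/diff_locallyP; rewrite D.
Qed.

(** The increment is telescoped along the staircase of [truncate]; on each edge the mean value
    theorem replaces it by a partial derivative taken within distance |h| of x, where continuity at
    x controls it. *)
Lemma C1_differentiable n (f : 'rV[R]_n -> R) (U : set 'rV[R]_n) (x : 'rV[R]_n) :
  open U -> U x ->
  (forall i y, U y -> derivable f y (ebase R i)) ->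
  (forall i, {for x, continuous (partial i f)}) ->
  differentiable f x /\ 'd f x = gradform f x :> (_ -> _).
Proof.
move=> oU Ux df cf.
have cg : continuous (gradform f x).
  move=> y; apply: continuous_sum_at => i.
  apply: continuousM; first exact: coord_continuous.
  exact: cst_continuous.
apply: (differentiable_estimate (df := gradform f x)) => // _/posnumP[e].
(* The denominator [n.+1] shares the error among n coordinates and stays nonzero when n = 0. *)
have en0 : 0 < e%:num / (n.+1)%:R :> R by rewrite divr_gt0.
have [d0 d0p d0U] := open_norm_ball oU Ux.
have : \forall h \near (0 : 'rV[R]_n), forall i,
    `|h| < d0 /\ (forall h', `|h'| <= `|h| ->
      `|partial i f (x + h') - partial i f x| < e%:num / (n.+1)%:R).
  apply: (filter_forall (nbhs_filter (0 : 'rV[R]_n))) => i.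
  have [d1 d1p H1] := continuous_norm_ball (cf i) en0.
  have d01 : 0 < Num.min d0 d1 by rewrite lt_min d0p d1p.
  apply: filterS (near0_norm_lt n d01) => h; rewrite lt_min => /andP[h0 h1].
  by split => // h' h'h; apply: H1; exact: le_lt_trans h'h _.
apply: filterS => h H.
have trn k : `|truncate k h| <= `|h|.
  apply: norm_row_le => // i; rewrite mxE; case: ifP => _; last by rewrite normr0.
  exact: norm_coord_le.
have E : f (h + x) - (f x + gradform f x h) =
    \sum_(i < n) (f (x + truncate i.+1 h) - f (x + truncate i h) - h 0 i * partial i f x).
  rewrite sumrB /gradform opprD addrA; congr (_ - _).
  rewrite -(big_mkord xpredT (fun i => f (x + truncate i.+1 h) - f (x + truncate i h))).
  rewrite telescope_sumr //; congr (f _ - f _).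
    by rewrite addrC; congr (_ + _); apply/rowP => i; rewrite mxE ltn_ord.
  by rewrite -[LHS]addr0; congr (_ + _); apply/rowP => i; rewrite !mxE.
rewrite E.
apply: le_trans (ler_norm_sum _ _ _) _.
apply: (@le_trans _ _ (\sum_(i < n) (e%:num / (n.+1)%:R * `|h|))); last first.
  rewrite sumr_const card_ord -[_ *+ n]mulr_natl mulrA ler_wpM2r //.
  rewrite mulrCA ler_piMr // ler_pdivrMr // mul1r ler_nat.
  exact: leqnSn.
apply: ler_sum => i _.
have [hd Hi] := H i.
have seg s : `|s| <= `|h 0 i| -> `|truncate i h + s *: ebase R i| <= `|h|.
  move=> sh; apply: norm_row_le => // j; rewrite !mxE /=.
  have [->|ji] := eqVneq j i.
    by rewrite ltnn mulr1 add0r (le_trans sh) ?norm_coord_le.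
  rewrite mulr0 addr0; case: ifP => _; last by rewrite normr0.
  exact: norm_coord_le.
rewrite truncateS addrA.
have [|s sh ->] := @line_mvt _ f (x + truncate i h) (ebase R i) (h 0 i).
  move=> s sh; apply: df; rewrite -addrA; apply: d0U.
  by apply: le_lt_trans hd; exact: seg.
rewrite -mulrBr normrM mulrC; apply: ler_pM => //; last exact: norm_coord_le.
by rewrite -addrA; apply/ltW/Hi; exact: seg.
Qed.

(** Schwarz's argument: the mixed second difference over a square of side t is t^2 times either
    mixed partial at some nearby point, and continuity at x identifies the two values. *)
Lemma partial_symmetric n (f : 'rV[R]_n -> R) (U : set 'rV[R]_n) (x : 'rV[R]_n)
    (i j : 'I_n) : open U -> U x ->
  (forall l y, U y -> derivable f y (ebase R l)) ->
  (forall l q y, U y -> derivable (partial l f) y (ebase R q)) ->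
  (forall l q, {for x, continuous (partial l (partial q f))}) ->
  partial i (partial j f) x = partial j (partial i f) x.
Proof.
move=> oU Ux df ddf cf; apply/eqP; rewrite -subr_eq0 -normr_le0; apply/ler_addgt0Pr => e e0.
rewrite add0r; have e20 : 0 < e / 2 by rewrite divr_gt0.
have [d0 d0p d0U] := open_norm_ball oU Ux.
have [d1 d1p H1] := continuous_norm_ball (cf i j) e20.
have [d2 d2p H2] := continuous_norm_ball (cf j i) e20.
(* A quarter of the smallest radius keeps the sum of two displacements of size at most t strictly
   inside all three balls. *)
pose t := Num.min d0 (Num.min d1 d2) / 4.
have m0 : 0 < Num.min d0 (Num.min d1 d2) by rewrite !lt_min d0p d1p d2p.
have t0 : 0 < t by rewrite divr_gt0.
have small (a b : R) (p q : 'I_n) : `|a| <= t -> `|b| <= t ->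
    `|a *: ebase R p + b *: ebase R q| < Num.min d0 (Num.min d1 d2).
  move=> at_ bt; apply: (le_lt_trans (ler_normD _ _)); rewrite !normrZ.
  have Hp : forall (c : R) (l : 'I_n), `|c| <= t -> `|c| * `|ebase R l| <= t.
    by move=> c l ct; apply: le_trans ct; rewrite ler_piMr // norm_ebase_le.
  apply: (le_lt_trans (lerD (Hp _ p at_) (Hp _ q bt))).
  by rewrite /t; move: m0; generalize (Num.min d0 (Num.min d1 d2)) => M M0; lra.
clearbody t.
have Uab (a b : R) p q : `|a| <= t -> `|b| <= t -> U (x + a *: ebase R p + b *: ebase R q).
  move=> at_ bt; rewrite -addrA; apply: d0U; have := small a b p q at_ bt.
  by rewrite !lt_min => /and3P[].
have mix p q : exists a b, [/\ `|a| <= t, `|b| <= t &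
    f (x + t *: ebase R p + t *: ebase R q) - f (x + t *: ebase R p)
    - (f (x + t *: ebase R q) - f x) =
    t * (t * partial q (partial p f) (x + a *: ebase R p + b *: ebase R q))].
  pose g y := f (y + t *: ebase R q) - f y.
  have tt : `|t| <= t by rewrite ger0_norm // ltW.
  have dsh y : derivable f (y + t *: ebase R q) (ebase R p) ->
      is_derive y (ebase R p) (fun z => f (z + t *: ebase R q))
       (partial p f (y + t *: ebase R q)).
    move=> D.
    have E : (fun h : R => h^-1 *: (((fun z => f (z + t *: ebase R q)) \o shift y)
         (h *: ebase R p) - f (y + t *: ebase R q))) =
       (fun h : R => h^-1 *: ((f \o shift (y + t *: ebase R q)) (h *: ebase R p)
         - f (y + t *: ebase R q))).
      by apply/funext => h /=; rewrite addrA.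
    by split; rewrite /partial /derivable /derive E.
  have dg s : `|s| <= `|t| -> is_derive (x + s *: ebase R p) (ebase R p) g
      (partial p f (x + s *: ebase R p + t *: ebase R q) - partial p f (x + s *: ebase R p)).
    move=> st; have st' : `|s| <= t by rewrite (le_trans st).
    apply: is_deriveB.
      by apply: dsh; apply: df; exact: Uab.
    apply: DeriveDef => //; apply: df.
    have := Uab s 0 p q st'; rewrite scale0r addr0; apply.
    by rewrite normr0 ltW.
  have [|a a1 E1] := @line_mvt _ g x (ebase R p) t.
    by move=> s st; have [] := dg s st.
  have a1' : `|a| <= t by rewrite (le_trans a1).
  have [|b b1 E2] := @line_mvt _ (partial p f) (x + a *: ebase R p) (ebase R q) t.
    by move=> s st; apply: ddf; apply: Uab => //; exact: (le_trans st).
  exists a, b; split => //; first exact: (le_trans b1).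
  rewrite -/(g _) -/(g x) in E1 *; rewrite [LHS]E1; congr (_ * _).
  by have [_ ->] := dg a a1; rewrite E2.
have [a [b [a1 b1 E1]]] := mix i j.
have [c [d [c1 d1' E2]]] := mix j i.
have E : partial j (partial i f) (x + a *: ebase R i + b *: ebase R j) =
         partial i (partial j f) (x + c *: ebase R j + d *: ebase R i).
  have tn0 : t != 0 by rewrite gt_eqF.
  suff Q : t * (t * partial j (partial i f) (x + a *: ebase R i + b *: ebase R j)) =
    t * (t * partial i (partial j f) (x + c *: ebase R j + d *: ebase R i)).
    by move/(mulfI tn0)/(mulfI tn0): Q.
  apply: (etrans (esym E1)); apply: etrans E2.
  have -> : x + t *: ebase R j + t *: ebase R i = x + t *: ebase R i + t *: ebase R j.
    by rewrite addrAC.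
  generalize (f (x + t *: ebase R i + t *: ebase R j)) (f (x + t *: ebase R j))
    (f (x + t *: ebase R i)) (f x) => p q r w.
  by ring.
have K1 := H1 _ (_ : `|c *: ebase R j + d *: ebase R i| < d1).
have K2 := H2 _ (_ : `|a *: ebase R i + b *: ebase R j| < d2).
have {}K1 : `|partial i (partial j f) (x + c *: ebase R j + d *: ebase R i) - partial i (partial j f) x| < e / 2.
  rewrite -addrA; apply: K1; have := small c d j i c1 d1'; by rewrite !lt_min => /and3P[].
have {}K2 : `|partial j (partial i f) (x + a *: ebase R i + b *: ebase R j) - partial j (partial i f) x| < e / 2.
  rewrite -addrA; apply: K2; have := small a b i j a1 b1; by rewrite !lt_min => /and3P[].
move: E K1 K2.
generalize (partial j (partial i f) (x + a *: ebase R i + b *: ebase R j))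
  (partial i (partial j f) (x + c *: ebase R j + d *: ebase R i))
  (partial i (partial j f) x) (partial j (partial i f) x) => p q r w -> K1 K2.
by apply: (le_trans (ler_distD q r w)); rewrite distrC (splitr e) lerD // ltW.
Qed.

End Calculus.

(** * Directional derivatives, smoothness of finite order, constancy on connected sets *)

Section Smooth.
Variable R : realType.

Section IsDerive.
Variables (n : nat) (x v : 'rV[R]_n).
Implicit Types f g : 'rV[R]_n -> R.

Lemma is_derive_add f g (a b : R) : is_derive x v f a -> is_derive x v g b ->
  is_derive x v (fun y => f y + g y) (a + b).
Proof. exact: is_deriveD. Qed.

Lemma is_derive_mul f g (a b : R) : is_derive x v f a -> is_derive x v g b ->
  is_derive x v (fun y => f y * g y) (f x * b + a * g x).
Proof.
move=> da db; apply: is_derive_eq (is_deriveM da db) _.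
by congr (_ + _); exact: mulrC.
Qed.

Lemma is_derive_const (c : R) : is_derive x v (fun=> c) 0.
Proof. exact: is_derive_cst. Qed.

Lemma is_derive_bigsum (I : Type) (r : seq I) (P : pred I)
    (F : I -> 'rV[R]_n -> R) (d : I -> R) :
  (forall i, is_derive x v (F i) (d i)) ->
  is_derive x v (fun y => \sum_(i <- r | P i) F i y) (\sum_(i <- r | P i) d i).
Proof.
move=> H; elim: r => [|i r IH].
  rewrite big_nil [X in is_derive _ _ X](_ : _ = fun=> 0).
    exact: is_derive_const.
  by apply/funext => y; rewrite big_nil.
rewrite big_cons [X in is_derive _ _ X](_ : _ = fun y =>
  if P i then F i y + \sum_(j <- r | P j) F j y else \sum_(j <- r | P j) F j y).
  by case: (P i) => //; exact: is_derive_add.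
by apply/funext => y; rewrite big_cons.
Qed.

Lemma is_derive_coord i : is_derive x v (fun y : 'rV[R]_n => y 0 i) (v 0 i).
Proof.
have D0 : derivable (id : 'rV[R]_n -> 'rV[R]_n) x v by exact: derivable_id.
split; first exact: (derivable_mxP _ _ _).1 D0 0 i.
have := derive_mx D0.
by rewrite derive_id => /rowP/(_ i); rewrite mxE.
Qed.

(** The device by which identities are differentiated throughout: an equality on an open set passes
    to derivatives computed separately for its two sides. *)
Lemma is_derive_unique f g (a b : R) (U : set 'rV[R]_n) : open U -> U x ->
  (forall y, U y -> f y = g y) ->
  is_derive x v f a -> is_derive x v g b -> a = b.
Proof.
move=> oU Ux fg [_ <-] [_ <-]; apply: near_eq_derive.
have : nbhs x U by exact: open_nbhs_nbhs.
by apply: filterS.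
Qed.

End IsDerive.

Lemma differentiable_is_derive n (f : 'rV[R]_n -> R) x v :
  differentiable f x -> is_derive x v f ('D_v f x).
Proof. by move=> df; apply: DeriveDef => //; exact: diff_derivable. Qed.

Lemma differentiable_row n p (Phi : 'rV[R]_n -> 'rV[R]_p) x :
  (forall j, differentiable (fun y => Phi y 0 j) x) -> differentiable Phi x.
Proof.
move=> H; have -> : Phi = \sum_(j < p) (fun y => Phi y 0 j *: ebase R j).
  apply/funext => y; rewrite fct_sumE; exact: row_sum_delta.
by apply: differentiable_sum => j; apply: differentiableZl.
Qed.

Lemma derive_row_coord n p (Phi : 'rV[R]_n -> 'rV[R]_p) x v j :
  (forall j, differentiable (fun y => Phi y 0 j) x) ->
  ('D_v Phi x) 0 j = 'D_v (fun y => Phi y 0 j) x.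
Proof.
move=> H; rewrite derive_mx ?mxE //.
by apply: diff_derivable; exact: differentiable_row.
Qed.

Lemma derive_linear_sum n (f : 'rV[R]_n -> R) x v : differentiable f x ->
  'D_v f x = \sum_i v 0 i * partial i f x.
Proof.
move=> df; rewrite deriveE // {1}(row_sum_delta v) linear_sum.
by apply: eq_bigr => i _; rewrite linearZ /partial deriveE.
Qed.

Lemma derive_scale n (f : 'rV[R]_n -> R) x (a : R) v : differentiable f x ->
  'D_(a *: v) f x = a * 'D_v f x.
Proof. by move=> df; rewrite !deriveE // linearZ. Qed.

Lemma derive_add n (f : 'rV[R]_n -> R) x u v : differentiable f x ->
  'D_(u + v) f x = 'D_u f x + 'D_v f x.
Proof. by move=> df; rewrite !deriveE // linearD. Qed.

Lemma is_derive_comp n p (Phi : 'rV[R]_n -> 'rV[R]_p) (f : 'rV[R]_p -> R) x v :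
  (forall j, differentiable (fun y => Phi y 0 j) x) ->
  differentiable f (Phi x) ->
  is_derive x v (fun y => f (Phi y)) ('D_('D_v Phi x) f (Phi x)).
Proof.
move=> /differentiable_row dP df.
have dc : differentiable (f \o Phi) x by exact: differentiable_comp.
split; first exact: diff_derivable.
by rewrite [LHS]deriveE // diff_comp //= !deriveE.
Qed.

Lemma differentiable_comp_row n p (Phi : 'rV[R]_n -> 'rV[R]_p) (f : 'rV[R]_p -> R) x :
  (forall j, differentiable (fun y => Phi y 0 j) x) ->
  differentiable f (Phi x) -> differentiable (fun y => f (Phi y)) x.
Proof. by move=> /differentiable_row dP df; exact: differentiable_comp. Qed.

Lemma is_derive_curve n (f : 'rV[R]_n -> R) (c : R -> 'rV[R]_n) (t : R) w :
  is_derive t (1 : R) c w -> differentiable f (c t) ->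
  is_derive t (1 : R) (fun s => f (c s)) ('D_w f (c t)).
Proof.
move=> [/derivable1_diffP dc <-] df.
have dfc : differentiable (f \o c) t by exact: differentiable_comp.
split; first exact: diff_derivable.
by rewrite [LHS]deriveE // diff_comp //= !deriveE.
Qed.

(** Finite-order counterpart of [smooth_on]. Recursion on the order lets products be treated by
    induction: in the Leibniz rule the undifferentiated factors are used at the lower order, through
    [CnW]. *)
Fixpoint Cn n (U : set 'rV[R]_n) (p : nat) (f : 'rV[R]_n -> R) : Prop :=
  (forall x, U x -> {for x, continuous f}) /\
  if p is q.+1 then
    (forall i x, U x -> derivable f x (ebase R i)) /\
    (forall i, Cn U q (partial i f))
  else True.

Lemma CnW n U p (f : 'rV[R]_n -> R) : Cn U p.+1 f -> Cn U p f.
Proof.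
elim: p f => [|p IH] f [cf [df pf]]; split => //; split => // i.
exact: IH.
Qed.

Lemma smooth_Cn n (U : set 'rV[R]_n) f : smooth_on U f <-> forall p, Cn U p f.
Proof.
split=> [sf p|H].
  suff K l : Cn U p (iter_partial l f) by exact: (K [::]).
  elim: p l => [|p IH] l; split => //.
  - by move=> x Ux; have [] := sf l x Ux.
  - by move=> x Ux; have [] := sf l x Ux.
  - by split=> [i x Ux|i]; [have [_] := sf l x Ux; exact|exact: (IH (i :: l))].
have K l : forall p, Cn U p (iter_partial l f).
  by elim: l => //= i l IH p; have [_ [_ Hp]] := IH p.+1; exact: Hp.
by move=> l x Ux; have [cf [df _]] := K l 1%N; split => [|i]; [exact: cf|exact: df].
Qed.

Lemma Cn_ext n (U : set 'rV[R]_n) p f g : open U ->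
  (forall x, U x -> f x = g x) -> Cn U p f -> Cn U p g.
Proof.
move=> oU; have nU x : U x -> nbhs x U by move=> Ux; exact: open_nbhs_nbhs.
have cont f' g' : (forall x, U x -> f' x = g' x) ->
    forall x : 'rV[R]_n, U x -> {for x, continuous f'} -> {for x, continuous (g' : _ -> R)}.
  move=> fg x Ux cf; rewrite /prop_for /continuous_at -fg //.
  apply: (cvg_trans _ cf); apply: near_eq_cvg; first exact: nbhs_filter.
  by apply: filterS (nU x Ux) => y Uy; rewrite /= fg.
elim: p f g => [|p IH] f g fg [cf].
  by move=> _; split => // x Ux; exact: (cont f g fg x Ux (cf x Ux)).
move=> [df pf]; split=> [x Ux|]; first exact: (cont f g fg x Ux (cf x Ux)).
have E x : U x -> {near x, f =1 g}.
  by move=> Ux; apply: filterS (nU x Ux) => y; exact: fg.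
split=> [i x Ux|i]; first exact: near_eq_derivable (E x Ux) (df i x Ux).
apply: IH (pf i) => x Ux; apply: near_eq_derive; exact: E.
Qed.

Lemma Cn_add n (U : set 'rV[R]_n) p f g : open U -> Cn U p f -> Cn U p g ->
  Cn U p (fun x => f x + g x).
Proof.
move=> oU; elim: p f g => [|p IH] f g [cf H1] [cg H2].
  by split=> // x Ux; apply: continuousD; [exact: cf|exact: cg].
case: H1 H2 => df pf [dg pg]; split=> [x Ux|].
  by apply: continuousD; [exact: cf|exact: cg].
split=> [i x Ux|i]; first exact: derivableD (df i x Ux) (dg i x Ux).
apply: Cn_ext (IH _ _ (pf i) (pg i)) => // x Ux.
by rewrite /partial -deriveD //; [exact: df|exact: dg].
Qed.

Lemma Cn_mul n (U : set 'rV[R]_n) p f g : open U -> Cn U p f -> Cn U p g ->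
  Cn U p (fun x => f x * g x).
Proof.
move=> oU; elim: p f g => [|p IH] f g Hf Hg; have [cf H1] := Hf; have [cg H2] := Hg.
  by split=> // x Ux; apply: continuousM; [exact: cf|exact: cg].
case: H1 H2 => df pf [dg pg]; split=> [x Ux|].
  by apply: continuousM; [exact: cf|exact: cg].
split=> [i x Ux|i]; first exact: derivableM (df i x Ux) (dg i x Ux).
apply: Cn_ext (Cn_add oU (IH _ _ (CnW Hf) (pg i)) (IH _ _ (pf i) (CnW Hg))) => // x Ux.
have [_ <-] := is_derive_mul (derivableP (df i x Ux)) (derivableP (dg i x Ux)).
by [].
Qed.

Lemma Cn_cst n (U : set 'rV[R]_n) p (c : R) : Cn U p (fun=> c).
Proof.
elim: p c => [|p IH] c; split=> //; try by move=> x _; exact: cst_continuous.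
split=> [i x _|i]; first exact: derivable_cst.
rewrite (_ : partial i _ = fun=> 0) //.
by apply/funext => x; rewrite /partial derive_cst.
Qed.

Lemma smooth_energy n (F : 'rV[R]_n -> R) (U : set 'rV[R]_n) : open U ->
  smooth_on U F -> smooth_on U (energy F).
Proof.
move=> oU /smooth_Cn sF; apply/smooth_Cn => p.
exact: Cn_mul oU (Cn_mul oU (sF p) (sF p)) (Cn_cst U p 2^-1).
Qed.

Section SmoothOn.
Variables (n : nat) (U : set 'rV[R]_n).
Hypothesis oU : open U.
Implicit Type f : 'rV[R]_n -> R.

Lemma smooth_partial f i : smooth_on U f -> smooth_on U (partial i f).
Proof.
by move=> sf l x Ux; have := sf (rcons l i) x Ux; rewrite /iter_partial foldr_rcons.
Qed.

Lemma smooth_continuous f x : smooth_on U f -> U x -> {for x, continuous f}.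
Proof. by move=> sf Ux; have [] := sf [::] x Ux. Qed.

Lemma smooth_differentiable f x : smooth_on U f -> U x -> differentiable f x.
Proof.
move=> sf Ux; apply: (C1_differentiable oU Ux _ _).1 => [i y Uy|i].
  by have [_] := sf [::] y Uy; exact.
by have [] := sf [:: i] x Ux.
Qed.

Lemma smooth_symmetric f x i j : smooth_on U f -> U x ->
  partial i (partial j f) x = partial j (partial i f) x.
Proof.
move=> sf Ux; apply: (partial_symmetric _ _ oU Ux) => [l y Uy|l q y Uy|l q].
- by have [_] := sf [::] y Uy; exact.
- by have [_] := sf [:: l] y Uy; exact.
- by have [] := sf [:: l; q] x Ux.
Qed.

End SmoothOn.

Lemma smooth_sub n (U V : set 'rV[R]_n) f : V `<=` U -> smooth_on U f -> smooth_on V f.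
Proof. by move=> VU sf l x /VU; exact: sf. Qed.

(** All directional derivatives vanish, so f is constant on small balls by the mean value theorem; a
    level set is then both open and closed in U. *)
Lemma constant_of_partials0 n (U : set 'rV[R]_n) (f : 'rV[R]_n -> R) :
  open U -> connected U -> smooth_on U f ->
  (forall i x, U x -> partial i f x = 0) ->
  forall x y, U x -> U y -> f x = f y.
Proof.
move=> oU cU sf d0 x0 y0 Ux0 Uy0.
have dir x v : U x -> 'D_v f x = 0.
  move=> Ux; rewrite derive_linear_sum; last exact: smooth_differentiable sf Ux.
  by rewrite big1 // => i _; rewrite d0 // mulr0.
have loc x : U x -> exists2 d : R, 0 < d & forall h, `|h| < d -> U (x + h) /\ f (x + h) = f x.
  move=> Ux; have [d d0' Ud] := open_norm_ball oU Ux; exists d => // h hd.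
  have seg (s : R) : `|s| <= `|1 : R| -> U (x + s *: h).
    rewrite normr1 => s1; apply: Ud; rewrite normrZ; apply: le_lt_trans hd.
    by rewrite ler_piMl.
  split; first exact: Ud.
  have [|s s1 E] := @line_mvt R n f x h 1.
    move=> s s1; apply: diff_derivable; apply: (smooth_differentiable oU sf); exact: seg.
  apply/eqP; rewrite -subr_eq0; move: E; rewrite scale1r => ->.
  by rewrite dir ?mulr0 //; exact: seg.
pose B := U `&` [set x | f x = f x0].
suff BU : B = U by have [_ /= ->] : B y0 by rewrite BU.
apply: cU.
- by exists x0.
- exists B; last by apply/seteqP; split=> [z Bz|z []//]; split=> //; case: Bz.
  rewrite openE => z [Uz fz]; have [d d0' H] := loc z Uz.
  apply/nbhs_ballP; exists d => // w; rewrite -ball_normE /= => wd.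
  have := H (w - z); rewrite distrC wd => /(_ isT); rewrite addrC subrK => -[Uw fw].
  by split=> //=; rewrite fw.
- exists (~` (U `&` [set x | f x <> f x0])); last first.
    apply/seteqP; split=> [z [Uz fz]|z [Uz nz]]; split=> //.
      by move=> [_ /=]; rewrite fz.
    by apply: contrapT => fz; apply: nz.
  apply: open_closedC; rewrite openE => z [Uz fz]; have [d d0' H] := loc z Uz.
  apply/nbhs_ballP; exists d => // w; rewrite -ball_normE /= => wd.
  have := H (w - z); rewrite distrC wd => /(_ isT); rewrite addrC subrK => -[Uw fw].
  by split=> //=; rewrite fw.
Qed.

End Smooth.

(** * Rotations and the block action *)

Section Rotations.
Variable R : realType.

Section RotationMatrix.
Variables (p : nat) (K : 'M[R]_p).
Hypotheses (skewK : K^T = - K) (K3 : K *m K *m K = - K).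

(** Rodrigues' formula: this is exp(t K), because K^3 = -K. *)
Definition rotmx (t : R) : 'M[R]_p := 1%:M + sin t *: K + (1 - cos t) *: (K *m K).

Lemma rotmxD s t : rotmx s *m rotmx t = rotmx (s + t).
Proof.
have K3' : K *m (K *m K) = - K by rewrite mulmxA.
have K4 : K *m K *m (K *m K) = - (K *m K) by rewrite mulmxA K3 mulNmx.
rewrite /rotmx !mulmxDl !mulmxDr !mul1mx !mulmx1 -!scalemxAl -!scalemxAr K3 K3' K4.
rewrite sinD cosD; move: (K *m K) => K2.
by apply/matrixP => i j; rewrite !mxE; ring.
Qed.

Lemma rotmx0 : rotmx 0 = 1%:M.
Proof. by rewrite /rotmx sin0 cos0 subrr !scale0r !addr0. Qed.

Lemma rotmx_tr t : (rotmx t)^T = rotmx (- t).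
Proof.
rewrite /rotmx !linearD /= trmx1 !linearZ /= trmx_mul skewK mulNmx mulmxN opprK.
by rewrite sinN cosN scalerN scaleNr.
Qed.

(** The determinant is 1 and not -1 because the rotation is the square of the rotation by t / 2. *)
Lemma rotmx_SO t : SO_mx (rotmx t).
Proof.
have H s : rotmx s *m (rotmx s)^T = 1%:M by rewrite rotmx_tr rotmxD subrr rotmx0.
split; first exact: H.
have -> : t = t / 2 + t / 2 by rewrite -splitr.
rewrite -rotmxD det_mulmx -[X in _ * X]det_tr -det_mulmx H det1.
by [].
Qed.

End RotationMatrix.

Definition dot p (u v : 'rV[R]_p) : R := \sum_i u 0 i * v 0 i.

Lemma mulmx_tr_dot p (u v : 'rV[R]_p) : u *m v^T = (dot u v)%:M.
Proof.
apply/matrixP => i j; rewrite !ord1 !mxE mulr1n.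
by apply: eq_bigr => l _; rewrite mxE.
Qed.

Lemma dotC p (u v : 'rV[R]_p) : dot u v = dot v u.
Proof. by apply: eq_bigr => i _; rewrite mulrC. Qed.

(** The generator K is the infinitesimal rotation in the plane of x and v, scaled so that x K = v
    and v K = -x; it satisfies K^3 = -K, as [rotmx] requires. *)
Lemma great_circle p (x v : 'rV[R]_p) (t : R) :
  dot x v = 0 -> dot v v = dot x x -> dot x x != 0 ->
  exists2 A, SO_mx A & x *m A^T = cos t *: x + sin t *: v.
Proof.
move=> xv vv xx; pose K := (dot x x)^-1 *: (x^T *m v - v^T *m x).
have xK : x *m K = v.
  rewrite -scalemxAr mulmxBr !mulmxA !mulmx_tr_dot xv !mul_scalar_mx scale0r subr0.
  by rewrite scalerA mulVf // scale1r.
have vK : v *m K = - x.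
  rewrite -scalemxAr mulmxBr !mulmxA !mulmx_tr_dot dotC xv vv !mul_scalar_mx scale0r.
  by rewrite sub0r scalerN scalerA mulVf // scale1r.
have skK : K^T = - K.
  by rewrite /K linearZ /= linearB /= !trmx_mul !trmxK -scalerN opprB.
have KK : K *m K = (dot x x)^-1 *: (- (x^T *m x) - v^T *m v).
  by rewrite {1}/K -scalemxAl mulmxBl -!mulmxA xK vK mulmxN.
have K3 : K *m K *m K = - K.
  rewrite KK -scalemxAl mulmxBl mulNmx -!mulmxA xK vK mulmxN opprK /K.
  by rewrite -scalerN opprB addrC.
(* The matrix acts through its transpose, which reverses the angle; hence the sign. *)
clear KK; clearbody K; exists (rotmx K (- t)); first exact: rotmx_SO.
rewrite rotmx_tr // opprK /rotmx !mulmxDr mulmx1 -!scalemxAr mulmxA xK vK.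
by apply/matrixP => i j; rewrite !mxE; ring.
Qed.

Section Blocks.
Variables (k m : nat).
Implicit Types (x y u v : 'rV[R]_(k + m)) (b : bool).

(** The value [true] stands for V' and [false] for V''; indexing by [bool] treats the two blocks
    uniformly. *)
Definition blk (i : 'I_(k + m)) : bool := (i < k)%N.

Definition bdot b u v : R := \sum_(i | blk i == b) u 0 i * v 0 i.

Definition bproj b u : 'rV[R]_(k + m) := \row_i (if blk i == b then u 0 i else 0).

Lemma bdotC b u v : bdot b u v = bdot b v u.
Proof. by apply: eq_bigr => i _; rewrite mulrC. Qed.

Lemma bdotDr b u v w : bdot b u (v + w) = bdot b u v + bdot b u w.
Proof. by rewrite -big_split; apply: eq_bigr => i _; rewrite mxE mulrDr. Qed.

Lemma bdotZr b u a v : bdot b u (a *: v) = a * bdot b u v.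
Proof. by rewrite big_distrr; apply: eq_bigr => i _; rewrite mxE /= mulrCA. Qed.

Lemma bdotDl b u v w : bdot b (u + v) w = bdot b u w + bdot b v w.
Proof. by rewrite bdotC bdotDr !(bdotC _ w). Qed.

Lemma bdotZl b u a v : bdot b (a *: u) v = a * bdot b u v.
Proof. by rewrite bdotC bdotZr bdotC. Qed.

Lemma bdot_projr b c u v : bdot b u (bproj c v) = if b == c then bdot b u v else 0.
Proof.
rewrite /bdot; case: eqP => [->|bc].
  by apply: eq_bigr => i ic; rewrite mxE ic.
rewrite big1 // => i /eqP ib; rewrite mxE ib.
by case: eqP => // E; rewrite mulr0.
Qed.

Lemma bdot_projl b c u v : bdot b (bproj c u) v = if b == c then bdot b u v else 0.
Proof. by rewrite bdotC bdot_projr bdotC. Qed.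

Lemma bdot_ge0 b u : 0 <= bdot b u u.
Proof. by apply: sumr_ge0 => i _; rewrite -expr2 sqr_ge0. Qed.

Lemma bdot_eq0 b u : bdot b u u = 0 -> forall i, blk i = b -> u 0 i = 0.
Proof.
move=> H i ib; apply/eqP.
have K j : blk j == b -> 0 <= u 0 j * u 0 j by rewrite -expr2 sqr_ge0.
have /eqP := psumr_eq0P K H (introT eqP ib).
by rewrite mulf_eq0 orbb.
Qed.

Lemma bprojD u : u = bproj true u + bproj false u.
Proof. by apply/rowP => i; rewrite !mxE; case: (blk i); rewrite ?addr0 ?add0r. Qed.

Lemma bproj_id b u : bproj b (bproj b u) = bproj b u.
Proof. by apply/rowP => i; rewrite !mxE; case: eqP. Qed.

Lemma bdotT u v : bdot true u v = dot (lsubmx u) (lsubmx v).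
Proof.
rewrite /bdot big_split_ord /= [X in _ + X]big1 ?addr0.
  rewrite /dot [RHS](eq_bigl (fun i => blk (lshift m i) == true)).
    by apply: eq_bigr => i _; rewrite !mxE.
  by move=> i; rewrite /blk /= ltn_ord.
by move=> i; rewrite /blk /= ltnNge leq_addr.
Qed.

Lemma bdotF u v : bdot false u v = dot (rsubmx u) (rsubmx v).
Proof.
rewrite /bdot big_split_ord /= [X in X + _]big1 ?add0r.
  rewrite /dot [RHS](eq_bigl (fun i => blk (rshift k i) == false)).
    by apply: eq_bigr => i _; rewrite !mxE.
  by move=> i; rewrite /blk /= ltnNge leq_addr.
by move=> i; rewrite /blk /= ltn_ord.
Qed.

Lemma bproj_lr u : (bproj true u = row_mx (lsubmx u) 0) * (bproj false u = row_mx 0 (rsubmx u)).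
Proof.
split; apply/rowP => i; case: (split_ordP i) => j ->;
  by rewrite mxE ?row_mxEl ?row_mxEr !mxE /blk /= ?ltn_ord // ltnNge leq_addr.
Qed.

Lemma bactE A' A'' x : bact A' A'' x = row_mx (lsubmx x *m A'^T) (rsubmx x *m A''^T).
Proof.
rewrite /bact -{1}(hsubmxK x) tr_block_mx !trmx0 mul_row_block !mulmx0.
by rewrite addr0 add0r.
Qed.

Lemma SO1 p : SO_mx (1%:M : 'M[R]_p).
Proof. by split; rewrite ?trmx1 ?mulmx1 ?det1. Qed.

Lemma dot_SO p (A : 'M[R]_p) (u v : 'rV[R]_p) : SO_mx A -> dot (u *m A^T) (v *m A^T) = dot u v.
Proof.
move=> [AA _]; have AA' : A^T *m A = 1%:M by exact: mulmx1C.
have := mulmx_tr_dot (u *m A^T) (v *m A^T).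
rewrite trmx_mul trmxK mulmxA -(mulmxA u) AA' mulmx1 mulmx_tr_dot.
by move=> /matrixP/(_ 0 0); rewrite !mxE !mulr1n.
Qed.

Lemma bdot_bact b A' A'' u v : SO_mx A' -> SO_mx A'' ->
  bdot b (bact A' A'' u) (bact A' A'' v) = bdot b u v.
Proof.
move=> SA SB; rewrite !bactE; case: b.
  by rewrite !bdotT !row_mxKl dot_SO.
by rewrite !bdotF !row_mxKr dot_SO.
Qed.

Lemma bproj_bact b A' A'' u : bproj b (bact A' A'' u) = bact A' A'' (bproj b u).
Proof.
case: b; rewrite !bproj_lr !bactE ?row_mxKl ?row_mxKr mul0mx //.
Qed.

(** For v in the block [b], orthogonal to that block of x and of the same length, this is a great
    circle in the block with initial velocity v, the other block staying fixed. *)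
Definition orbit_path b x v (t : R) := x + (cos t - 1) *: bproj b x + sin t *: v.

Lemma orbit_pathP b x v (t : R) :
  bproj b v = v -> bdot b x v = 0 -> bdot b v v = bdot b x x -> bdot b x x != 0 ->
  exists A' A'', [/\ SO_mx A', SO_mx A'' & bact A' A'' x = orbit_path b x v t].
Proof.
case: b; rewrite ?bdotT ?bdotF => vb xv vv xx.
  have [A SA E] := great_circle t xv vv xx.
  exists A, 1%:M; split => //; first exact: SO1.
  rewrite bactE E trmx1 mulmx1 /orbit_path -vb !bproj_lr row_mxKl.
  rewrite -[X in _ = X + _ + _](hsubmxK x) !scale_row_mx !add_row_mx !scaler0 !addr0.
  by congr row_mx; apply/rowP => i; rewrite !mxE; ring.
have [A SA E] := great_circle t xv vv xx.
exists 1%:M, A; split => //; first exact: SO1.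
rewrite bactE E trmx1 mulmx1 /orbit_path -vb !bproj_lr row_mxKr.
rewrite -[X in _ = X + _ + _](hsubmxK x) !scale_row_mx !add_row_mx !scaler0 !addr0.
by congr row_mx; apply/rowP => i; rewrite !mxE; ring.
Qed.

Lemma is_derive_scalel p (g : R -> R) (u : 'rV[R]_p) (t a : R) :
  is_derive t (1 : R) g a -> is_derive t (1 : R) (fun s => g s *: u) (a *: u).
Proof.
move=> [/derivable1_diffP dg <-].
have D : differentiable (fun s => g s *: u) t by exact: differentiableZl.
split; first exact: diff_derivable.
by rewrite deriveE // diffZl // deriveE.
Qed.

Lemma is_derive_orbit_path b x v (t : R) :
  is_derive t (1 : R) (orbit_path b x v) (- sin t *: bproj b x + cos t *: v).
Proof.
have D1 : is_derive t (1 : R) (cst x) 0 by exact: is_derive_cst.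
have D2 : is_derive t (1 : R) (fun s => (cos s - 1) *: bproj b x) (- sin t *: bproj b x).
  apply: is_derive_scalel; rewrite -[- sin t]subr0.
  exact: (is_deriveB (is_derive_cos t) (is_derive_cst (1 : R) t 1)).
have D3 : is_derive t (1 : R) (fun s => sin s *: v) (cos t *: v).
  by apply: is_derive_scalel; exact: is_derive_sin.
by have := is_deriveD (is_deriveD D1 D2) D3; rewrite add0r.
Qed.

(** Rescaled to the length of the block [b] of x, v becomes the initial velocity of an [orbit_path],
    along which f is constant. *)
Lemma derive_invariant (f : 'rV[R]_(k + m) -> R) b x v :
  (forall A' A'', SO_mx A' -> SO_mx A'' -> f (bact A' A'' x) = f x) ->
  differentiable f x -> bdot b x x != 0 -> bproj b v = v -> bdot b x v = 0 ->
  'D_v f x = 0.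
Proof.
move=> inv df xx vb xv.
have [v0|vv] := eqVneq (bdot b v v) 0.
  suff -> : v = 0 by rewrite derive0.
  apply/rowP => i; rewrite mxE; have [ib|ib] := eqVneq (blk i) b.
    exact: bdot_eq0 v0 i ib.
  by rewrite -vb mxE (negbTE ib).
pose s := Num.sqrt (bdot b x x / bdot b v v).
have q0 : 0 < bdot b x x / bdot b v v.
  by rewrite divr_gt0 // lt0r ?xx ?vv bdot_ge0.
have s0 : s != 0 by rewrite gt_eqF // sqrtr_gt0.
have H t := @orbit_pathP b x (s *: v) t.
have H1 : bproj b (s *: v) = s *: v.
  by rewrite -{2}vb; apply/rowP => i; rewrite !mxE; case: eqP => // _; rewrite mulr0.
have H2 : bdot b x (s *: v) = 0 by rewrite bdotZr xv mulr0.
have H3 : bdot b (s *: v) (s *: v) = bdot b x x.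
  by rewrite bdotZr bdotZl mulrA -expr2 sqr_sqrtr ?ltW // divfK.
have cst t : f (orbit_path b x (s *: v) t) = f x.
  by have [A [B [SA SB <-]]] := H t H1 H2 H3 xx; exact: inv.
have p0 : orbit_path b x (s *: v) 0 = x.
  by rewrite /orbit_path cos0 sin0 subrr !scale0r !addr0.
have := @is_derive_curve R _ f _ _ _ (is_derive_orbit_path b x (s *: v) 0).
rewrite p0 => /(_ df) [_].
rewrite (_ : (fun s0 => _) = fun=> f x); last exact/funext.
rewrite derive_cst sin0 cos0 oppr0 scale0r add0r scale1r derive_scale // => /esym/eqP.
by rewrite mulf_eq0 (negbTE s0) => /eqP.
Qed.

End Blocks.
End Rotations.

(** * Energies of Minkowski norms *)

Section MinkowskiNorms.
Variable R : realType.

Lemma open_nonzero n : open (~` [set (0 : 'rV[R]_n)]).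
Proof. by apply: closed_openC; exact: accessible_closed_set1 (@hausdorff_accessible _ (@norm_hausdorff _ _)) 0. Qed.

Lemma partialE n (f : 'rV[R]_n -> R) i x : partial i f x = 'D_(ebase R i) f x.
Proof. by []. Qed.

Lemma coord_delta n (i j : 'I_n) : ebase R i 0 j = (j == i)%:R.
Proof. by rewrite mxE eqxx. Qed.

(** The complement of a coordinate hyperplane is dense. This permits division by a coordinate, the
    excluded points being recovered by continuity. *)
Lemma zero_off_hyperplane n (U : set 'rV[R]_n) (g : 'rV[R]_n -> R) (l : 'I_n) :
  open U -> (forall y, U y -> {for y, continuous g}) ->
  (forall y, U y -> y 0 l != 0 -> g y = 0) -> forall y, U y -> g y = 0.
Proof.
move=> oU cg g0 y Uy; apply/eqP; apply: contraT => gy.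
have [yl|yl] := eqVneq (y 0 l) 0; last by rewrite g0 // eqxx in gy.
have [d d0 Ud] := open_norm_ball oU Uy.
have gy' : 0 < `|g y| by rewrite normr_gt0.
have [e e0 ge] := continuous_norm_ball (cg y Uy) gy'.
pose t := Num.min d e / 2.
have m0 : 0 < Num.min d e by rewrite lt_min d0 e0.
have t0 : 0 < t by rewrite divr_gt0.
have tm : `|t *: ebase R l| < Num.min d e.
  rewrite normrZ gtr0_norm //; apply: (@le_lt_trans _ _ t).
    by rewrite ler_piMr ?norm_ebase_le // ltW.
  by rewrite /t ltr_pdivrMr // ltr_pMr // ltr1n.
move: tm; rewrite lt_min => /andP[td te].
have := ge _ te; rewrite g0 ?sub0r ?normrN ?ltxx //; first exact: Ud.
by rewrite !mxE yl add0r !eqxx /= mulr1 gt_eqF.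
Qed.

Section Energy.
Variables (n : nat) (F : 'rV[R]_n -> R).
Hypothesis mF : minkowski_norm F.
Implicit Types x y : 'rV[R]_n.
Local Notation E := (energy F).
Local Notation U0 := (~` [set (0 : 'rV[R]_n)]).

Lemma nonzeroP (x : 'rV[R]_n) : x != 0 -> U0 x.
Proof. by move=> x0 /= E0; rewrite E0 eqxx in x0. Qed.

Lemma energy_smooth : smooth_on U0 E.
Proof. by have [_ [_ [sF _]]] := mF; apply: smooth_energy => //; exact: open_nonzero. Qed.

Lemma energy_differentiable x : x != 0 -> differentiable E x.
Proof.
by move=> x0; exact: (smooth_differentiable (@open_nonzero n) energy_smooth (nonzeroP x0)).
Qed.

Lemma partial_energy_differentiable i x : x != 0 -> differentiable (partial i E) x.
Proof.
move=> x0; apply: (smooth_differentiable (@open_nonzero n) _ (nonzeroP x0)).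
by apply: smooth_partial; exact: energy_smooth.
Qed.

Lemma hessian_energy_sym i j x : x != 0 ->
  partial i (partial j E) x = partial j (partial i E) x.
Proof.
by move=> x0; exact: (smooth_symmetric (@open_nonzero n) _ _ energy_smooth (nonzeroP x0)).
Qed.

Lemma energy_homogeneous (t : R) x : 0 < t -> E (t *: x) = t ^+ 2 * E x.
Proof. by move=> t0; have [_ [_ [_ [_ [hF _]]]]] := mF; rewrite /energy hF // exprMn mulrA. Qed.

Lemma partial_energy_homogeneous i (t : R) x : 0 < t -> x != 0 ->
  partial i E (t *: x) = t * partial i E x.
Proof.
move=> t0 x0; have t0' : t != 0 by rewrite gt_eqF.
have tx0 : t *: x != 0 by rewrite scaler_eq0 negb_or t0'.
have D1 : is_derive x (ebase R i) (fun y => E (t *: y)) ('D_(t *: ebase R i) E (t *: x)).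
  apply: is_derive_eq (is_derive_comp _ (Phi := fun y => t *: y) _ _) _.
  - move=> j; have -> : (fun y : 'rV[R]_n => (t *: y) 0 j) = t *: (fun y => y 0 j).
      by apply/funext => y; rewrite mxE.
    by apply: differentiableZ; exact: differentiable_coord.
  - exact: energy_differentiable.
  - by have [_ ->] : is_derive x (ebase R i) (fun y => t *: y) (t *: ebase R i)
      by exact: (is_deriveZ t (is_derive_id x (ebase R i))).
have D2 : is_derive x (ebase R i) (fun y => t ^+ 2 * E y) (t ^+ 2 * partial i E x).
  apply: is_derive_eq (is_derive_mul (is_derive_const _ _ (t ^+ 2))
    (differentiable_is_derive _ (energy_differentiable x0))) _.
  by rewrite mul0r addr0.
have := is_derive_unique openT I (fun y _ => energy_homogeneous y t0) D1 D2.
rewrite derive_scale; last exact: energy_differentiable.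
by rewrite expr2 -mulrA => /(mulfI t0').
Qed.

Lemma homogeneous_euler (f : 'rV[R]_n -> R) x (d : nat) : differentiable f x ->
  (forall t : R, 0 < t -> f (t *: x) = t ^+ d * f x) -> 'D_x f x = d%:R * f x.
Proof.
move=> df hf.
have D1 : is_derive (1 : R) (1 : R) (fun s => f (s *: x)) ('D_x f x).
  have D := is_derive_scalel x (is_derive_id (1 : R) (1 : R)).
  rewrite scale1r in D; have := is_derive_curve D; rewrite scale1r; exact.
have D2 : is_derive (1 : R) (1 : R) (fun s => s ^+ d * f x) (d%:R * f x).
  have DX : is_derive (1 : R) (1 : R) (fun s => s ^+ d) (d%:R : R).
    split; first exact: exprn_derivable.
    by rewrite exp_derive expr1n /GRing.scale /= !mulr1.
  apply: is_derive_eq (is_deriveM DX (is_derive_cst (f x) (1 : R) 1)) _.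
  by rewrite scaler0 add0r /GRing.scale /= mulrC.
have [_ <-] := D1; have [_ <-] := D2; apply: near_eq_derive.
near=> s; apply: hf; near: s.
exact: lt_nbhsr.
Unshelve. all: by end_near. Qed.

Lemma energy_euler2 i x : x != 0 ->
  \sum_j x 0 j * partial j (partial i E) x = partial i E x.
Proof.
move=> x0; have df := partial_energy_differentiable i x0.
rewrite -derive_linear_sum // (homogeneous_euler (d := 1) df) ?mul1r // => t t0.
by rewrite expr1 partial_energy_homogeneous.
Qed.

Lemma energy_euler1 x : x != 0 -> \sum_j x 0 j * partial j E x = 2 * E x.
Proof.
move=> x0; have df := energy_differentiable x0.
rewrite -derive_linear_sum // (homogeneous_euler (d := 2) df) // => t t0.
by rewrite energy_homogeneous.
Qed.

Lemma hess_metricE y u v : hess_metric F y u v =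
  \sum_i \sum_j u 0 i * partial i (partial j E) y * v 0 j.
Proof.
rewrite /hess_metric /bform mxE exchange_big /=; apply: eq_bigr => j _.
by rewrite !mxE big_distrl /=; apply: eq_bigr => i _; rewrite !mxE.
Qed.

Lemma hess_metric_diag y : y != 0 -> hess_metric F y y y = F y ^+ 2.
Proof.
move=> y0; rewrite hess_metricE exchange_big /=.
rewrite (eq_bigr (fun j => y 0 j * partial j E y)) => [|j _].
  by rewrite energy_euler1 // /energy mulrC divfK.
by rewrite -big_distrl /= energy_euler2 // mulrC.
Qed.

Lemma hess_metric_ebase y i j :
  hess_metric F y (ebase R i) (ebase R j) = partial i (partial j E) y.
Proof.
rewrite hess_metricE (bigD1 i) //= [X in _ + X]big1 ?addr0 => [|l li].
  rewrite (bigD1 j) //= [X in _ + X]big1 ?addr0 => [|l lj].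
    by rewrite !coord_delta !eqxx mul1r mulr1.
  by rewrite !coord_delta (negbTE lj) mulr0.
by rewrite big1 // => q _; rewrite coord_delta (negbTE li) !mul0r.
Qed.

End Energy.

Section BlockEnergy.
Variables (k m : nat) (F : 'rV[R]_(k + m) -> R).
Hypotheses (mF : minkowski_norm F) (iF : block_invariant_fun F).
Implicit Types x y : 'rV[R]_(k + m).
Local Notation E := (energy F).

(** The rotation field x_i e_j - x_j e_i is tangent to the orbits. If the whole block of x vanishes,
    both sides are zero. *)
Lemma energy_rot x i j : x != 0 -> blk i = blk j ->
  x 0 i * partial j E x = x 0 j * partial i E x.
Proof.
move=> x0 ij; have [xb|xb] := eqVneq (bdot (blk i) x x) 0.
  by rewrite !(bdot_eq0 xb) // !mul0r.
pose v := x 0 i *: ebase R j - x 0 j *: ebase R i.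
have dE := energy_differentiable mF x0.
suff : 'D_v E x = 0.
  rewrite /v -scaleNr derive_add // !derive_scale // mulNr => /eqP.
  by rewrite subr_eq0 => /eqP.
apply: (derive_invariant (b := blk i)) => //.
- by move=> A B SA SB; rewrite /energy iF.
- apply/rowP => l; rewrite /v !mxE /=; case: (blk l =P blk i) => // li.
  have -> : (l == j) = false by apply/negbTE/eqP => lj; apply: li; rewrite lj ij.
  have -> : (l == i) = false by apply/negbTE/eqP => lj; apply: li; rewrite lj.
  by rewrite !mulr0 subrr.
rewrite /v -scaleNr bdotDr !bdotZr.
have D l : blk l = blk i -> bdot (blk i) x (ebase R l) = x 0 l.
  move=> li; rewrite /bdot (bigD1 l) ?li ?eqxx //= coord_delta eqxx mulr1.
  by rewrite big1 ?addr0 // => q /andP[_ ql]; rewrite coord_delta (negbTE ql) mulr0.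
by rewrite !D // mulNr mulrC subrr.
Qed.

(** The action is linear and commutes with [bproj], so the difference quotients at the two points
    coincide. This makes [pairing] constant on orbits. *)
Lemma radial_derive_invariant b A' A'' x : SO_mx A' -> SO_mx A'' ->
  'D_(bproj b (bact A' A'' x)) E (bact A' A'' x) = 'D_(bproj b x) E x.
Proof.
move=> SA SB; rewrite bproj_bact.
suff H : (fun h : R => h^-1 *: ((E \o shift (bact A' A'' x)) (h *: bact A' A'' (bproj b x))
      - E (bact A' A'' x))) =
    (fun h : R => h^-1 *: ((E \o shift x) (h *: bproj b x) - E x)).
  by rewrite /derive H.
apply/funext => h /=; have -> : h *: bact A' A'' (bproj b x) + bact A' A'' x =
  bact A' A'' (h *: bproj b x + x) by rewrite /bact mulmxDl scalemxAl.
by rewrite /energy !iF.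
Qed.

End BlockEnergy.
End MinkowskiNorms.

(* Otherwise unification compares derivatives by unfolding them to limits. *)
Local Opaque partial derive.

(** * Constancy of a block-orthogonal Hessian *)

Lemma sum_blocks (R : realType) (k m : nat) (h : bool -> R) (u v : 'rV[R]_(k + m)) :
  \sum_i h (blk i) * (u 0 i * v 0 i) = \sum_b h b * bdot b u v.
Proof.
rewrite (partition_big (@blk k m) xpredT) //=; apply: eq_bigr => b _.
by rewrite /bdot big_distrr /=; apply: eq_bigr => i /eqP ->.
Qed.

Section ConstantHessian.
Variable R : realType.
Variables (k m : nat) (F : 'rV[R]_(k + m) -> R) (C : set 'rV[R]_(k + m)).
Hypotheses (k0 : (0 < k)%N) (m0 : (0 < m)%N).
Hypotheses (mF : minkowski_norm F) (iF : block_invariant_fun F).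
Hypotheses (oC : open C) (cC : connected C) (C0 : C `<=` ~` [set 0]).
Hypothesis orthF : forall y (v' : 'rV[R]_k) (v'' : 'rV[R]_m), C y ->
  hess_metric F y (row_mx v' 0) (row_mx 0 v'') = 0.
Local Notation E := (energy F).
Local Notation H i j := (partial i (partial j E)).

Let nz y : C y -> y != 0.
Proof. by move=> /C0 /= yn; apply/eqP. Qed.

Let sE : smooth_on C E.
Proof. exact: smooth_sub C0 (energy_smooth mF). Qed.

Let sH i j : smooth_on C (H i j).
Proof. by do 2! apply: smooth_partial. Qed.

Let symH i j y : C y -> H i j y = H j i y.
Proof. by move=> Cy; apply: hessian_energy_sym => //; exact: nz. Qed.

Let off_block i j y : C y -> blk i != blk j -> H i j y = 0.
Proof.
move=> Cy; wlog bi : i j / blk i.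
  move=> W ij; have [bi|bi] := boolP (blk i); first exact: W.
  rewrite symH //; apply: W; last by rewrite eq_sym.
  by move: ij; rewrite (negbTE bi); case: (blk j).
rewrite bi; case bj : (blk j) => // _.
rewrite -hess_metric_ebase.
have Ei : ebase R i = bproj true (ebase R i).
  apply/rowP => l; rewrite [RHS]mxE coord_delta; case: (l =P i) => [->|_]; first by rewrite bi eqxx.
  by case: ifP.
have Ej : ebase R j = bproj false (ebase R j).
  apply/rowP => l; rewrite [RHS]mxE coord_delta; case: (l =P j) => [->|_]; first by rewrite bj.
  by case: ifP.
by rewrite Ei Ej !bproj_lr orthF.
Qed.

Let dE i y v : C y -> is_derive y v (partial i E) ('D_v (partial i E) y).
Proof.
move=> Cy; apply: differentiable_is_derive.
by apply: partial_energy_differentiable => //; exact: nz.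
Qed.

Let rot_diff i j l y : C y -> blk i = blk j ->
  y 0 i * H l j y + (i == l)%:R * partial j E y =
  y 0 j * H l i y + (j == l)%:R * partial i E y.
Proof.
move=> Cy ij.
have D p q : is_derive y (ebase R l) (fun z => z 0 p * partial q E z)
    (y 0 p * H l q y + (p == l)%:R * partial q E y).
  rewrite -coord_delta partialE; exact: is_derive_mul (is_derive_coord _ _ _) (dE _ _ _).
apply: (is_derive_unique oC Cy _ (D i j) (D j i)) => z Cz.
by apply: energy_rot => //; exact: nz.
Qed.

(** For i and l in one block, [rot_diff] is multiplied by z_j and summed over the block. The Euler
    relation, cut down to the block by [off_block], turns the left side into z_i E_l; the right side
    is |z_b|^2 E_li + z_l E_i, and [energy_rot] cancels the first-order terms. *)
Let off_diag i l y : C y -> i != l -> H l i y = 0.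
Proof.
move=> Cy il; have [bil|bil] := eqVneq (blk i) (blk l); last first.
  by apply: off_block => //; rewrite eq_sym.
apply: (zero_off_hyperplane (l := l) oC) Cy => [z Cz|z Cz zl].
  exact: smooth_continuous (sH l i) Cz.
have bz : bdot (blk l) z z != 0.
  by apply: contraNneq zl => zb; apply/eqP; exact: (bdot_eq0 zb).
suff : bdot (blk l) z z * H l i z = 0.
  by move/eqP; rewrite mulf_eq0 (negbTE bz) => /eqP.
have EL : \sum_(j | blk j == blk l) z 0 j * H l j z = partial l E z.
  rewrite -(energy_euler2 mF l (nz Cz)) [RHS](bigID (fun j => blk j == blk l)) /=.
  rewrite [X in _ = _ + X]big1 ?addr0 => [|j jl]; last by rewrite off_block ?mulr0.
  by apply: eq_bigr => j _; rewrite symH.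
have : \sum_(j | blk j == blk l) z 0 j * (z 0 i * H l j z + (i == l)%:R * partial j E z) =
       \sum_(j | blk j == blk l) z 0 j * (z 0 j * H l i z + (j == l)%:R * partial i E z).
  by apply: eq_bigr => j /eqP jl; congr (_ * _); apply: rot_diff => //; rewrite bil jl.
rewrite (negbTE il) (eq_bigr (fun j => z 0 i * (z 0 j * H l j z))); last first.
  by move=> j _; rewrite mul0r addr0 mulrCA.
rewrite -big_distrr /= EL.
rewrite (eq_bigr (fun j => z 0 j * z 0 j * H l i z + z 0 j * (j == l)%:R * partial i E z)); last first.
  by move=> j _; rewrite mulrDr !mulrA.
rewrite big_split /= -!big_distrl /= -/(bdot (blk l) z z).
rewrite (bigD1 l) //= eqxx mulr1 [X in (_ + X) * _]big1 => [|j /andP[_ jl]]; last first.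
  by rewrite (negbTE jl) mulr0.
rewrite addr0 (energy_rot mF iF (nz Cz) bil) => /eqP.
by rewrite -subr_eq0 opprD addrCA subrr addr0 oppr_eq0 => /eqP.
Qed.

(** A third derivative with two distinct indices is, after reordering, the derivative of an
    off-diagonal entry, which is identically zero. The pure one comes from differentiating E_i = x_i
    E_ii, which gives x_i E_iii = 0. *)
Let third0 q i j y : C y -> partial q (H i j) y = 0.
Proof.
have loc p a b z : C z -> a != b -> partial p (H a b) z = 0.
  move=> Cz ab; rewrite partialE -(derive_cst (0 : R) z (ebase R p)); apply: near_eq_derive.
  have : nbhs z C by exact: open_nbhs_nbhs.
  by apply: filterS => w Cw; rewrite off_diag // eq_sym.
move=> Cy; have [<-{j}|ij] := eqVneq i j; last exact: loc.
have [->{q}|qi] := eqVneq q i; last first.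
  rewrite (smooth_symmetric oC (f := partial i E)) //; first exact: loc.
  exact: smooth_partial.
apply: (zero_off_hyperplane (l := i) oC) Cy => [z Cz|z Cz zi].
  exact: smooth_continuous (smooth_partial _ (sH i i)) Cz.
have EL w : C w -> partial i E w = w 0 i * H i i w.
  move=> Cw; rewrite -{1}(energy_euler2 mF i (nz Cw)) (bigD1 i) //= big1 ?addr0 // => j ji.
  by rewrite off_diag ?mulr0 // eq_sym.
have D : is_derive z (ebase R i) (fun w => w 0 i * H i i w)
    (z 0 i * partial i (H i i) z + 1 * H i i z).
  rewrite partialE.
  have := is_derive_coord z (ebase R i) i; rewrite coord_delta eqxx => D1.
  apply: is_derive_mul D1 _; apply: differentiable_is_derive.
  exact: (smooth_differentiable oC (sH i i) Cz).
have := is_derive_unique oC Cz EL (dE i _ Cz) D.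
rewrite mul1r -partialE => /eqP.
by rewrite eq_sym -subr_eq0 addrK mulf_eq0 (negbTE zi) => /eqP.
Qed.

Lemma hessian_constant i j x y : C x -> C y -> H i j x = H i j y.
Proof.
by move=> Cx Cy; apply: (constant_of_partials0 oC cC (sH i j)) => // q z; exact: third0.
Qed.

Lemma hess_metric_constant : C !=set0 -> exists c : bool -> R,
  (forall b, 0 < c b) /\
  forall y u v, C y -> hess_metric F y u v = \sum_b c b * bdot b u v.
Proof.
move=> [y0 Cy0].
pose it : 'I_(k + m) := lshift m (Ordinal k0).
pose jf : 'I_(k + m) := rshift k (Ordinal m0).
pose idx b : 'I_(k + m) := if b then it else jf.
have blk_idx b : blk (idx b) = b.
  by case: b; rewrite /blk /= ?k0 // addn0 ltnn.
exists (fun b => H (idx b) (idx b) y0); split.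
  move=> b; rewrite -hess_metric_ebase.
  have [_ [_ [_ [_ [_ pd]]]]] := mF; apply: pd; first exact: nz.
  apply/eqP => /rowP/(_ (idx b)); rewrite coord_delta eqxx mxE => /eqP.
  by rewrite oner_eq0.
move=> y u v Cy.
(* Diagonal entries of one block agree: [rot_diff] reduces to E_i = w_i E_jj, which is compared with
   E_i = w_i E_ii where w_i is nonzero. *)
have diagH i z : C z -> H i i z - H (idx (blk i)) (idx (blk i)) z = 0.
  move: (blk_idx (blk i)); move: (idx (blk i)) => j bj Cz.
  have [<-|ne] := eqVneq i j; first by rewrite subrr.
  apply: (zero_off_hyperplane (l := i) oC (g := fun z => _ - _)) Cz => [w Cw|w Cw wi].
    by apply: continuousB; exact: smooth_continuous (sH _ _) Cw.
  have EL : partial i E w = w 0 i * H i i w.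
    rewrite -{1}(energy_euler2 mF i (nz Cw)) (bigD1 i) //= big1 ?addr0 // => l li.
    by rewrite (off_diag (i := i) (l := l) Cw) ?mulr0 // eq_sym.
  have := rot_diff (i := j) (j := i) j Cw bj.
  rewrite (off_diag Cw ne) (negbTE ne) eqxx mul0r mul1r addr0 mulr0 add0r EL.
  by move/(mulfI wi) => ->; rewrite subrr.
rewrite hess_metricE.
rewrite (eq_bigr (fun i => H (idx (blk i)) (idx (blk i)) y0 * (u 0 i * v 0 i))) => [|i _].
  exact: (sum_blocks (fun b => H (idx b) (idx b) y0)).
rewrite (bigD1 i) //= big1 ?addr0 => [|j ji]; last by rewrite off_diag ?mulr0 ?mul0r.
have -> : H i i y = H (idx (blk i)) (idx (blk i)) y0.
  by apply: (etrans (hessian_constant i i Cy Cy0)); apply/subr0_eq; exact: diagH.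
by rewrite mulrAC mulrC.
Qed.

End ConstantHessian.

(** * First-order consequences of the isometry equation *)

(** If the determinant vanished, (c, -a) and (d, -b) would lie in the trivial left kernel and the
    matrix would be zero, which is absurd; so Cramer's rule applies. *)
Lemma det2_injective (R : realType) (a b c d : R) :
  (forall q r, q * a + r * c = 0 -> q * b + r * d = 0 -> q = 0 /\ r = 0) ->
  forall s t, s * a + t * b = 0 -> s * c + t * d = 0 -> s = 0 /\ t = 0.
Proof.
move=> H s t E1 E2; have [D|D] := eqVneq (a * d - b * c) 0; last first.
  split; apply: (mulIf D); rewrite mul0r.
    by transitivity ((s * a + t * b) * d - (s * c + t * d) * b); [ring|rewrite E1 E2; ring].
  by transitivity ((s * c + t * d) * a - (s * a + t * b) * c); [ring|rewrite E1 E2; ring].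
have [c0 a0] : c = 0 /\ - a = 0.
  by apply: H; [ring|rewrite -[RHS]oppr0 -D; ring].
have [d0 b0] : d = 0 /\ - b = 0 by apply: H; [rewrite -[RHS]D; ring|ring].
have [] := H 1 0; rewrite ?c0 ?d0 ?mulr0 ?mul1r ?addr0.
- by rewrite -[a]opprK a0 oppr0.
- by rewrite -[b]opprK b0 oppr0.
by move/eqP; rewrite oner_eq0.
Qed.

Lemma cos_double_neq1 (R : realType) (x : R) : 0 < x < pi -> cos (x *+ 2) != 1.
Proof.
move=> /sin_gt0_pi sx; have s2 : 0 < sin x ^+ 2 by rewrite exprn_gt0.
have := cos2Dsin2 x; rewrite cos_mulr2n => E; apply/eqP => c1.
by move: (sin x ^+ 2) (cos x ^+ 2) s2 E c1 => p q *; lra.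
Qed.

Lemma open_nonvanish (R : realType) (n : nat) (O : set 'rV[R]_n) (h : 'rV[R]_n -> R) :
  open O -> (forall z, O z -> {for z, continuous h}) -> open (O `&` [set z | h z != 0]).
Proof.
move=> oO ch; rewrite openE => y [Oy hy].
have hy' : 0 < `|h y| by rewrite normr_gt0.
have [d d0 Hd] := continuous_norm_ball (ch y Oy) hy'.
have [d' d'0 Hd'] := open_norm_ball oO Oy.
apply/nbhs_ballP; exists (Num.min d d'); first by rewrite /= lt_min d0.
move=> w; rewrite -ball_normE /= lt_min distrC => /andP[w1 w2].
have yw : y + (w - y) = w by rewrite addrC subrK.
have := Hd' _ w2; have := Hd _ w1; rewrite !yw => K1 K2.
split=> //=; apply/eqP => h0; move: K1.
by rewrite h0 sub0r normrN ltxx.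
Qed.

(** Index 1 is a block with several coordinates, index 2 a block with one; c1 and c2 stand for c_b
    |x_b|^2, and t tells whether the radial direction is that of block 1. The two equations are the
    sum rules for G and for A; the inequality on a1 is the period bound [pairing_le]. *)
Lemma slope_bounds_of_sums (R : realType) (t : bool) (a1 a2 f1 f2 c1 c2 G : R) :
  a1 * f1 <= c1 -> 0 < c1 -> 0 < c2 -> 0 < f1 -> 0 < f2 ->
  (if t then 2 * a1 else 0) * f1 + G * f2 = 2 * (if t then c1 else c2) ->
  a1 * f1 + a2 * f2 = c1 + c2 -> 0 < a2 /\ 0 <= G <= 2 * a2.
Proof.
move=> le1 c10 c20 f10 f20 E1 E2.
have A2 : 0 < a2 * f2 by lra.
have G0 : 0 <= G * f2 by case: t E1 => E1; lra.
have G2 : G * f2 <= 2 * a2 * f2 by case: t E1 => E1; lra.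
rewrite pmulr_lgt0 // in A2; rewrite pmulr_lge0 // in G0; rewrite ler_pM2r // in G2.
by rewrite G0 G2.
Qed.

Lemma rate_of_sums (R : realType) (f a n G : bool -> R) :
  (forall b, 0 < f b) -> (forall b, 0 < a b /\ 0 <= G b <= 2 * a b) ->
  \sum_b G b * f b = 2 * \sum_b f b * n b * (G b - a b * n b) ->
  forall b, G b = 2 * a b * n b.
Proof.
move=> f0 B E b.
(* with g = G/2: a (g - 2 n g + a n^2) = (a n - g)^2 + g (a - g) *)
pose T b := f b * (G b / 2 - n b * G b + a b * n b ^+ 2).
have key b' : 4 * a b' * T b' = f b' * ((2 * a b' * n b' - G b') ^+ 2 + G b' * (2 * a b' - G b')).
  by rewrite /T; field.
have key0 b' : 0 <= G b' * (2 * a b' - G b').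
  by have [_ /andP[g0 g1]] := B b'; rewrite mulr_ge0 // subr_ge0.
have T0 b' : 0 <= T b'.
  have [a0 _] := B b'; have a40 : 0 < 4 * a b' by rewrite mulr_gt0.
  rewrite -(pmulr_rge0 _ a40) key mulr_ge0 ?addr_ge0 ?sqr_ge0 //.
  exact: ltW.
have : \sum_b T b = 0.
  move: E; rewrite !big_bool /= /T.
  by move: (f true) (f false) (a true) (a false) (n true) (n false) (G true) (G false) => *; lra.
move=> /psumr_eq0P /(_ b isT) => Tb.
have {}Tb : T b = 0 by apply: Tb.
have := key b; rewrite Tb mulr0 => /esym/eqP; rewrite mulf_eq0 gt_eqF //=.
rewrite paddr_eq0 ?sqr_ge0 // sqrf_eq0 subr_eq0 => /andP[/eqP -> _].
by [].
Qed.

(** The permutation argument behind the uniqueness of the Levi-Civita connection: six alternate uses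
    of the two symmetries return to S p q r with the opposite sign. *)
Lemma sym_antisym0 (R : realType) (I : Type) (S : I -> I -> I -> R) :
  (forall p q r, S p q r = S q p r) -> (forall p q r, S p q r = - S p r q) ->
  forall p q r, S p q r = 0.
Proof.
move=> sym anti p q r; have : S p q r = - S p q r.
  by rewrite {1}anti sym anti opprK sym anti sym.
by move/eqP; rewrite -addr_eq0 -mulr2n mulrn_eq0 /= => /eqP.
Qed.

Section IsometryEquation.
Variables (R : realType) (k m : nat).
Local Notation V := 'rV[R]_(k + m).
Variables (F : V -> R) (C : set V) (c : bool -> R) (Phi : V -> V).
Hypotheses (mF : minkowski_norm F) (iF : block_invariant_fun F).
Hypotheses (oC : open C) (c_gt0 : forall b, 0 < c b).
Hypotheses (sPhi : smooth_map_on C Phi) (Phi_neq0 : forall y, C y -> Phi y != 0).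
Hypothesis Phi_homogeneous : forall (t : R) y, 0 < t -> C y -> Phi (t *: y) = t *: Phi y.
Hypothesis isoPhi : forall y u v, C y ->
  hess_metric F (Phi y) ('D_u Phi y) ('D_v Phi y) = \sum_b c b * bdot b u v.
Hypothesis orbPhi : maps_orbits C Phi.
Implicit Types (x y z u v w : V) (b e : bool).

Definition Phic (Phi : V -> V) i y : R := Phi y 0 i.
Local Notation Z := (Phic Phi).
(** The Legendre dual coordinates of [Phi y]. *)
Definition dualc i y : R := partial i (energy F) (Phi y).
Local Notation P := dualc.
Definition radius2 (Phi : V -> V) b y : R := bdot b (Phi y) (Phi y).
Local Notation f := (radius2 Phi).
(** The share of the block [b] in F(Phi y)^2, and also the radial derivative of the energy in that
    block ([pairingE]). *)
Definition pairing b y : R := \sum_(i | blk i == b) Z i y * P i y.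
Local Notation A := pairing.

Let Z_smooth i : smooth_on C (Z i).
Proof. exact: sPhi. Qed.

Lemma Phic_differentiable i y : C y -> differentiable (Z i) y.
Proof. by move=> Cy; exact: (smooth_differentiable oC (Z_smooth i) Cy). Qed.

Lemma jacE y v i : C y -> ('D_v Phi y) 0 i = 'D_v (Z i) y.
Proof. by move=> Cy; apply: derive_row_coord => j; exact: Phic_differentiable. Qed.

Lemma jacD y u v : C y -> 'D_(u + v) Phi y = 'D_u Phi y + 'D_v Phi y.
Proof.
move=> Cy; apply/rowP => i; rewrite [RHS]mxE !jacE // derive_add //.
exact: Phic_differentiable.
Qed.

Lemma jacZ y a v : C y -> 'D_(a *: v) Phi y = a *: 'D_v Phi y.
Proof.
move=> Cy; apply/rowP => i; rewrite [RHS]mxE !jacE // derive_scale //.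
exact: Phic_differentiable.
Qed.

Lemma dualc_differentiable i y : C y -> differentiable (P i) y.
Proof.
move=> Cy; apply: differentiable_comp_row => [j|]; first exact: Phic_differentiable.
by apply: partial_energy_differentiable => //; exact: Phi_neq0.
Qed.

Lemma dual_isometry y u v : C y ->
  \sum_i 'D_u (P i) y * 'D_v (Z i) y = \sum_b c b * bdot b u v.
Proof.
move=> Cy; rewrite -(isoPhi u v Cy) hess_metricE exchange_big /=.
apply: eq_bigr => i _; rewrite -big_distrl /= jacE //; congr (_ * _).
have [_ ->] : is_derive y u (P i) ('D_('D_u Phi y) (partial i (energy F)) (Phi y)).
  apply: is_derive_comp => [j|]; first exact: Phic_differentiable.
  by apply: partial_energy_differentiable => //; exact: Phi_neq0.
apply: derive_linear_sum; apply: partial_energy_differentiable => //.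
exact: Phi_neq0.
Qed.

(** By [energy_rot] at [Phi y], the gradient is parallel to the position within a block. Stated
    without division, it includes points where that block of [Phi y] vanishes. *)
Lemma radius_dual b y j : C y -> blk j = b -> f b y * P j y = A b y * Z j y.
Proof.
move=> Cy jb; rewrite /f /pairing !big_distrl /=; apply: eq_bigr => i /eqP ib.
rewrite -!mulrA; congr (_ * _); rewrite [RHS]mulrC.
by apply: energy_rot => //; [exact: Phi_neq0|rewrite ib jb].
Qed.

Lemma jac_euler y : C y -> 'D_y Phi y = Phi y.
Proof.
move=> Cy; apply/rowP => i; rewrite jacE //.
rewrite (homogeneous_euler (d := 1)) ?mul1r //; first exact: Phic_differentiable.
by move=> t t0; rewrite /Phic Phi_homogeneous // mxE expr1.
Qed.

Lemma norm_isometry y : C y -> F (Phi y) ^+ 2 = \sum_b c b * bdot b y y.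
Proof.
move=> Cy; rewrite -(isoPhi y y Cy) jac_euler // hess_metric_diag //.
exact: Phi_neq0.
Qed.

Lemma sum_pairing y : C y -> \sum_b A b y = \sum_b c b * bdot b y y.
Proof.
move=> Cy; rewrite -norm_isometry //.
transitivity (\sum_i Z i y * P i y).
  by rewrite [RHS](partition_big (@blk k m) xpredT).
rewrite /dualc /Phic (energy_euler1 mF (Phi_neq0 Cy)) /energy mulrC divfK //.
Qed.

Lemma radius_invariant b y A' A'' : C y -> SO_mx A' -> SO_mx A'' ->
  f b (bact A' A'' y) = f b y.
Proof.
move=> Cy SA SB; have [B' [B'' [SB' [SB'' E]]]] := orbPhi Cy SA SB.
by rewrite /radius2 E bdot_bact.
Qed.

Lemma pairingE b y : C y -> A b y = 'D_(bproj b (Phi y)) (energy F) (Phi y).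
Proof.
move=> Cy; rewrite derive_linear_sum; last by apply: energy_differentiable => //; exact: Phi_neq0.
rewrite /pairing big_mkcond /=; apply: eq_bigr => i _; rewrite [in RHS]mxE.
by case: eqP => // _; rewrite mul0r.
Qed.

Hypothesis iC : block_invariant_set C.

Lemma pairing_invariant b y A' A'' : C y -> SO_mx A' -> SO_mx A'' ->
  A b (bact A' A'' y) = A b y.
Proof.
move=> Cy SA SB; have [B' [B'' [SB' [SB'' E]]]] := orbPhi Cy SA SB.
rewrite !pairingE //; last exact: iC.
by rewrite E radial_derive_invariant.
Qed.

(** What the divisions by |y_b|^2 and |Z_b|^2 require; an open condition ([generic_open]) and a
    dense one ([generic_dense]). *)
Definition generic (Phi : V -> V) y := forall b, bdot b y y != 0 /\ radius2 Phi b y != 0.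
(** The tangent space of the orbit of y, when no block of y is zero. *)
Definition tangent y v := forall b, bdot b y v = 0.

Lemma radius_differentiable b y : C y -> differentiable (f b) y.
Proof.
move=> Cy; have -> : f b = \sum_(i < k + m) (if blk i == b then Z i * Z i else cst 0).
  apply/funext => z; rewrite fct_sumE /radius2 /bdot big_mkcond /=.
  by apply: eq_bigr => i _; case: ifP.
apply: differentiable_sum => i; case: ifP => _; last exact: differentiable_cst.
by apply: differentiableM; exact: Phic_differentiable.
Qed.

Lemma pairing_differentiable b y : C y -> differentiable (A b) y.
Proof.
move=> Cy; have -> : A b = \sum_(i < k + m) (if blk i == b then Z i * P i else cst 0).
  apply/funext => z; rewrite fct_sumE /pairing big_mkcond /=.
  by apply: eq_bigr => i _; case: ifP.
apply: differentiable_sum => i; case: ifP => _; last exact: differentiable_cst.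
by apply: differentiableM; [exact: Phic_differentiable|exact: dualc_differentiable].
Qed.

Lemma tangent_invariant (h : V -> R) y v : C y -> (forall b, bdot b y y != 0) ->
  differentiable h y ->
  (forall A' A'', SO_mx A' -> SO_mx A'' -> h (bact A' A'' y) = h y) ->
  tangent y v -> 'D_v h y = 0.
Proof.
move=> Cy gy dh ih tv; rewrite (bprojD v) derive_add //.
by rewrite !(derive_invariant ih dh (gy _) (bproj_id _ _)) ?addr0 // bdot_projr eqxx.
Qed.

Lemma is_derive_radius b y v : C y ->
  is_derive y v (f b) (2 * bdot b (Phi y) ('D_v Phi y)).
Proof.
move=> Cy; have D i := differentiable_is_derive v (Phic_differentiable i Cy).
apply: is_derive_eq (is_derive_bigsum _ _ (fun i => is_derive_mul (D i) (D i))) _.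
rewrite /bdot big_distrr /=; apply: eq_bigr => i _.
by rewrite jacE // -/(Z i y); ring.
Qed.

(** Orbits go into orbits, so |Z_b|^2 is constant along an orbit and its derivative along v
    vanishes. *)
Lemma tangent_jac y v : C y -> generic Phi y -> tangent y v -> tangent (Phi y) ('D_v Phi y).
Proof.
move=> Cy gy tv b; have [_ D] := is_derive_radius b v Cy.
have : 'D_v (f b) y = 0.
  apply: tangent_invariant tv => //; first by move=> e; have [] := gy e.
    exact: radius_differentiable.
  by move=> A' A'' SA SB; exact: radius_invariant.
rewrite D => /eqP; rewrite mulf_eq0 => /orP[|/eqP//].
by rewrite pnatr_eq0.
Qed.

(** The factor between P and Z on the block [b]; it takes the default value 0 where that block of
    [Phi y] vanishes. *)
Definition slope b y : R := A b y / f b y.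
Local Notation a := slope.

Lemma dual_slope y j : C y -> generic Phi y -> P j y = a (blk j) y * Z j y.
Proof.
move=> Cy gy; have [_ fy] := gy (blk j); apply: (mulfI fy).
by rewrite radius_dual // mulrA [f _ _ * _]mulrC divfK.
Qed.

Lemma slope_differentiable b y : C y -> generic Phi y -> differentiable (a b) y.
Proof.
move=> Cy gy; have [_ fy] := gy b.
apply: (@differentiableM _ _ (A b) (fun z => (f b z)^-1)).
  exact: pairing_differentiable.
by apply: (@differentiableV _ _ (f b)) => //; exact: radius_differentiable.
Qed.

Lemma tangent_slope b y v : C y -> generic Phi y -> tangent y v -> 'D_v (a b) y = 0.
Proof.
move=> Cy gy tv; apply: tangent_invariant tv => //.
- by move=> e; have [] := gy e.
- exact: slope_differentiable.
- by move=> A' A'' SA SB; rewrite /slope pairing_invariant // radius_invariant.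
Qed.

Lemma generic_open : open (C `&` [set y | generic Phi y]).
Proof.
have E : C `&` [set y | generic Phi y] =
    C `&` [set y | (bdot true y y * f true y) * (bdot false y y * f false y) != 0].
  apply/seteqP; split=> y [Cy] /=.
    by move=> gy; split=> //; rewrite !mulf_neq0 //; have [] := gy true; have [] := gy false.
  rewrite !mulf_eq0 !negb_or => /andP[/andP[? ?] /andP[? ?]]; split=> // -[]; by split.
rewrite E; apply: (open_nonvanish oC) => y Cy.
have cn b : {for y, continuous (fun z : V => bdot b z z)}.
  apply: differentiable_continuous.
  have -> : (fun z : V => bdot b z z) =
    \sum_(i < k + m) (if blk i == b then (fun z : V => z 0 i) * (fun z : V => z 0 i) else cst 0).
    apply/funext => z; rewrite fct_sumE /bdot big_mkcond /=.
    by apply: eq_bigr => i _; case: ifP.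
  apply: differentiable_sum => i; case: ifP => _; last exact: differentiable_cst.
  by apply: differentiableM; exact: differentiable_coord.
have cf b : {for y, continuous (f b)} by apply: differentiable_continuous; exact: radius_differentiable.
by apply: continuousM; apply: continuousM; (exact: cn || exact: cf).
Qed.

Lemma derive_dual y v j : C y -> generic Phi y ->
  'D_v (P j) y = a (blk j) y * 'D_v (Z j) y + 'D_v (a (blk j)) y * Z j y.
Proof.
move=> Cy gy.
apply: (is_derive_unique generic_open (conj Cy gy) (fun z '(conj Cz gz) => dual_slope j Cz gz)).
  by apply: differentiable_is_derive; exact: dualc_differentiable.
apply: is_derive_mul; apply: differentiable_is_derive.
  exact: slope_differentiable.
exact: Phic_differentiable.
Qed.

Lemma metric_slope y u v : C y -> generic Phi y ->
  \sum_b (a b y * bdot b ('D_u Phi y) ('D_v Phi y)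
    + 'D_u (a b) y * bdot b (Phi y) ('D_v Phi y)) = \sum_b c b * bdot b u v.
Proof.
move=> Cy gy; rewrite -(dual_isometry u v Cy) [RHS](partition_big (@blk k m) xpredT) //=.
apply: eq_bigr => b _; rewrite /bdot !big_distrr -big_split /=.
apply: eq_bigr => i /eqP ib; rewrite derive_dual // ib !jacE // -/(Z i y).
ring.
Qed.

Lemma metric_tangent y u v : C y -> generic Phi y -> tangent y u ->
  \sum_b a b y * bdot b ('D_u Phi y) ('D_v Phi y) = \sum_b c b * bdot b u v.
Proof.
move=> Cy gy tu; rewrite -(metric_slope u v Cy gy); apply: eq_bigr => b _.
by rewrite tangent_slope // mul0r addr0.
Qed.

Lemma metric_eq0 u : \sum_b c b * bdot b u u = 0 -> u = 0.
Proof.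
rewrite big_bool /= => /eqP.
rewrite paddr_eq0 ?mulr_ge0 ?bdot_ge0 ?ltW // !mulf_eq0 !(gt_eqF (c_gt0 _)) /= => /andP[/eqP u1 /eqP u2].
apply/rowP => i; rewrite mxE; case Eb : (blk i).
  exact: (bdot_eq0 u1).
exact: (bdot_eq0 u2).
Qed.

Definition jacmx (Phi : V -> V) y : 'M[R]_(k + m) := \matrix_(i, j) partial i (Phic Phi j) y.

Lemma jac_mulmx y v : C y -> 'D_v Phi y = v *m jacmx Phi y.
Proof.
move=> Cy; apply/rowP => i; rewrite jacE // derive_linear_sum; last exact: Phic_differentiable.
by rewrite mxE; apply: eq_bigr => j _; rewrite mxE.
Qed.

Lemma jacmx_unit y : C y -> jacmx Phi y \in unitmx.
Proof.
move=> Cy; rewrite -row_free_unit; apply: inj_row_free => v; rewrite -jac_mulmx // => J0.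
apply: metric_eq0; rewrite -(dual_isometry v v Cy) big1 // => i _.
by rewrite -jacE // J0 mxE mulr0.
Qed.

Lemma jac_surj y w : C y -> exists u, 'D_u Phi y = w.
Proof.
by move=> Cy; exists (w *m invmx (jacmx Phi y)); rewrite jac_mulmx // mulmxKV // jacmx_unit.
Qed.

Lemma tangent_decomp y u : (forall b, bdot b y y != 0) ->
  tangent y (u - \sum_e (bdot e y u / bdot e y y) *: bproj e y).
Proof.
move=> gy b; rewrite big_bool /= -scaleN1r bdotDr bdotZr bdotDr !bdotZr !bdot_projr.
by case: b; rewrite /= divfK // ?mulr0 ?addr0 ?add0r mulN1r subrr.
Qed.

(** Modulo orbit tangents, D Phi acts on the two radial directions by the 2 by 2 matrix of the
    [phi b (bproj e y)]. Surjectivity of D Phi gives this matrix a trivial left kernel, so a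
    preimage u of a tangent vector has no radial components. *)
Lemma tangent_jac_surj y w : C y -> generic Phi y -> tangent (Phi y) w ->
  exists2 v, tangent y v & 'D_v Phi y = w.
Proof.
move=> Cy gy tw; have gy1 b : bdot b y y != 0 by have [] := gy b.
have alg (s t q r p1 p2 p3 p4 : R) : q * (s * p1 + t * p2) + r * (s * p3 + t * p4) =
    s * (q * p1 + r * p3) + t * (q * p2 + r * p4) by ring.
pose phi b u := bdot b (Phi y) ('D_u Phi y).
have phiE b u : phi b u = \sum_e (bdot e y u / bdot e y y) * phi b (bproj e y).
  have T := tangent_jac Cy gy (tangent_decomp u gy1) b.
  have := T; rewrite jacD // bdotDr -scaleN1r jacZ // bdotZr => /eqP.
  rewrite mulN1r subr_eq0 => /eqP; rewrite /phi => ->.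
  by rewrite !big_bool /= jacD // bdotDr !jacZ // !bdotZr.
have [u Ju] := jac_surj w Cy; exists u => //.
have K := @det2_injective R (phi true (bproj true y)) (phi true (bproj false y))
  (phi false (bproj true y)) (phi false (bproj false y)).
have {}K := K _ (bdot true y u / bdot true y y) (bdot false y u / bdot false y y).
have [||| s0 t0] := K.
- move=> q r E1 E2.
  have Q x : q * phi true x + r * phi false x = 0.
    rewrite (phiE true) (phiE false) !big_bool /=.
    move: (bdot true y x / _) (bdot false y x / _) => s t.
    rewrite alg.
    by rewrite E1 E2 !mulr0 addr0.
  (* Testing on a preimage of the radial vector of the image block [b] isolates one coefficient. *)
  have Qb b : (if b then q else r) = 0.
    have [x Jx] := jac_surj (bproj b (Phi y)) Cy.
    have := Q x; rewrite /phi Jx !bdot_projr.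
    have [_ fy] := gy b; move: fy; rewrite /radius2.
    case: b {Jx} => /= fy; rewrite mulr0 ?addr0 ?add0r => /eqP;
      by rewrite mulf_eq0 (negbTE fy) orbF => /eqP.
  by split; [exact: (Qb true)|exact: (Qb false)].
- by have := phiE true u; rewrite big_bool /= => <-; rewrite /phi Ju.
- by have := phiE false u; rewrite big_bool /= => <-; rewrite /phi Ju.
move=> b; move: s0 t0 => /eqP s0 /eqP t0.
move: s0 t0; rewrite !mulf_eq0 !invr_eq0 !(negbTE (gy1 _)) !orbF => /eqP s0 /eqP t0.
by case: b.
Qed.

(** Only the component of D_(x_e) Z along Z in the block [b]; that nothing else remains is
    [radial_jac]. *)
Definition radial_rate (Phi : V -> V) e b y : R :=
  bdot b (Phi y) ('D_(bproj e y) Phi y) / radius2 Phi b y.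

(** The remainder w of D_(x_e) Z after removal of its radial parts is tangent, hence the image of a
    tangent v. By [metric_tangent] the squared length of v equals its g1-product with x_e, which is
    zero. *)
Lemma radial_jac e y i : C y -> generic Phi y ->
  'D_(bproj e y) (Z i) y = radial_rate Phi e (blk i) y * Z i y.
Proof.
move=> Cy gy; pose n b := radial_rate Phi e b y.
pose J := 'D_(bproj e y) Phi y.
pose w : V := \row_i (J 0 i - n (blk i) * Z i y).
have wE b u : bdot b w u = bdot b J u - n b * bdot b (Phi y) u.
  rewrite /bdot big_distrr -sumrB; apply: eq_bigr => j /eqP jb.
  by rewrite mxE jb -/(Z j y) /=; ring.
have tw : tangent (Phi y) w.
  move=> b; have [_ fy] := gy b.
  by rewrite bdotC wE bdotC -/(radius2 Phi b y) /n /radial_rate divfK // subrr.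
have [v tv Jv] := tangent_jac_surj Cy gy tw.
have K1 := metric_tangent (bproj e y) Cy gy tv.
have K2 := metric_tangent v Cy gy tv.
have vy : \sum_b c b * bdot b v (bproj e y) = 0.
  by rewrite big1 // => b _; rewrite bdot_projr bdotC tv; case: ifP; rewrite mulr0.
have : v = 0.
  apply: metric_eq0; apply: (etrans (esym K2)); apply: etrans (etrans K1 vy).
  rewrite Jv -/J; apply: eq_bigr => b _.
  have -> : bdot b w J = bdot b w w; last by [].
  by rewrite [RHS]wE (bdotC b (Phi y)) (bdotC b w (Phi y)) tw mulr0 subr0 bdotC.
move=> v0; have : w 0 i = 0 by rewrite -Jv v0 derive0 mxE.
by rewrite mxE -/(n _) /J jacE // => /eqP; rewrite subr_eq0 => /eqP.
Qed.

(** * Second-order identities along linear vector fields *)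

Definition second_deriv i y u v : R :=
  \sum_l \sum_j u 0 l * v 0 j * partial l (partial j (Z i)) y.

Lemma second_deriv_sym i y u v : C y -> second_deriv i y u v = second_deriv i y v u.
Proof.
move=> Cy; rewrite /second_deriv exchange_big /=; apply: eq_bigr => l _; apply: eq_bigr => j _.
by rewrite (smooth_symmetric oC j l (Z_smooth i) Cy) [u 0 j * _]mulrC.
Qed.

Lemma is_derive_mulmx (K : 'M[R]_(k + m)) y v j :
  is_derive y v (fun z : V => (z *m K) 0 j) ((v *m K) 0 j).
Proof.
have -> : (fun z : V => (z *m K) 0 j) = (fun z => \sum_l z 0 l * K l j).
  by apply/funext => z; rewrite mxE.
rewrite [X in is_derive _ _ _ X]mxE.
have D l := is_derive_mul (is_derive_coord y v l) (is_derive_const y v (K l j)).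
apply: is_derive_eq (is_derive_bigsum _ _ D) _.
by apply: eq_bigr => l _; rewrite mulr0 add0r.
Qed.

(** Where no block of y is zero, every orbit tangent at y extends to a field z K with K block-skew,
    which is tangent at all points. Identities between tangent vectors can thus be differentiated in
    any direction; [dlinfield] is the derivative obtained. *)
Definition linfield (K : 'M[R]_(k + m)) i z : R := 'D_(z *m K) (Z i) z.
Definition dlinfield (K : 'M[R]_(k + m)) i y v : R :=
  second_deriv i y v (y *m K) + 'D_(v *m K) (Z i) y.

Lemma is_derive_linfield K i y v : C y ->
  is_derive y v (linfield K i) (dlinfield K i y v).
Proof.
move=> Cy; have D j : is_derive y v (partial j (Z i)) ('D_v (partial j (Z i)) y).
  apply: differentiable_is_derive.
  exact: (smooth_differentiable oC (smooth_partial j (Z_smooth i)) Cy).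
have DS := is_derive_bigsum (index_enum _) xpredT
  (fun j => is_derive_mul (is_derive_mulmx K y v j) (D j)).
apply: (@near_eq_is_derive _ _ _ _ _ y v _ _ (is_derive_eq DS _)).
  have : nbhs y C by exact: open_nbhs_nbhs.
  apply: filterS => z Cz; rewrite /linfield derive_linear_sum //.
  exact: Phic_differentiable.
rewrite /dlinfield [X in _ = _ + X]derive_linear_sum; last exact: Phic_differentiable.
rewrite big_split /=; congr (_ + _); rewrite /second_deriv exchange_big /=; apply: eq_bigr => j _.
rewrite derive_linear_sum; last exact: (smooth_differentiable oC (smooth_partial j (Z_smooth i)) Cy).
by rewrite big_distrr /=; apply: eq_bigr => l _; rewrite mulrCA mulrA.
Qed.

Definition projmx e : 'M[R]_(k + m) := \matrix_(i, j) ((i == j) && (blk j == e))%:R.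

Lemma mulmx_projmx e z : z *m projmx e = bproj e z.
Proof.
apply/rowP => j; rewrite !mxE (bigD1 j) //= big1 ?addr0 => [|i ij].
  by rewrite mxE eqxx /=; case: eqP; rewrite ?mulr1 ?mulr0.
by rewrite mxE (negbTE ij) mulr0.
Qed.

(** The Lie algebra of the block diagonal rotation group. *)
Definition blockskew (K : 'M[R]_(k + m)) :=
  K^T = - K /\ forall i j, blk i != blk j -> K i j = 0.

Lemma bproj_mulmx e z K : blockskew K -> bproj e (z *m K) = bproj e z *m K.
Proof.
move=> [_ bK]; apply/rowP => j; rewrite !mxE; case: eqP => [je|/eqP je].
  apply: eq_bigr => i _; rewrite mxE; case: eqP => // /eqP ie.
  by rewrite bK ?mulr0 // je.
rewrite big1 // => i _; rewrite mxE; case: eqP => [ie|]; last by rewrite mul0r.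
by rewrite bK ?mulr0 // ie eq_sym.
Qed.

Lemma tangent_blockskew z K : blockskew K -> tangent z (z *m K).
Proof.
move=> sK b; have [KT _] := sK.
have E : bdot b z (z *m K) = \sum_i \sum_j bproj b z 0 i * bproj b z 0 j * K i j.
  transitivity (bdot b z (bproj b (z *m K))); first by rewrite bdot_projr eqxx.
  rewrite bproj_mulmx // exchange_big /= /bdot big_mkcond /=; apply: eq_bigr => j _.
  case: ifP => jb.
    rewrite mxE big_distrr /=; apply: eq_bigr => i _.
    by rewrite [bproj b z 0 j]mxE jb mulrA [z 0 j * _]mulrC.
  by rewrite big1 // => i _; rewrite [bproj b z 0 j]mxE jb mulr0 mul0r.
have : bdot b z (z *m K) = - bdot b z (z *m K).
  rewrite {1}E exchange_big E -sumrN /=; apply: eq_bigr => i _.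
  rewrite -sumrN; apply: eq_bigr => j _.
  have -> : K j i = - K i j by have := congr1 (fun M : 'M[R]_(k + m) => M i j) KT; rewrite !mxE.
  by rewrite mulrN [bproj b z 0 j * _]mulrC.
by move/eqP; rewrite -addr_eq0 -mulr2n mulrn_eq0 /= => /eqP.
Qed.

(** The infinitesimal rotation carrying y to v, block by block, when v is tangent at y. *)
Definition skew_of y v : 'M[R]_(k + m) := \matrix_(i, j)
  (if blk i == blk j then (y 0 i * v 0 j - v 0 i * y 0 j) / bdot (blk i) y y else 0).

Lemma skew_ofP y v : blockskew (skew_of y v).
Proof.
split.
  apply/matrixP => i j; rewrite !mxE eq_sym; case: eqP => [->|_]; last by rewrite oppr0.
  by rewrite -[RHS]mulNr; congr (_ / _); ring.
by move=> i j ij; rewrite mxE (negbTE ij).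
Qed.

Lemma mulmx_skew_of y v x : x *m skew_of y v = \row_j
  ((bdot (blk j) x y * v 0 j - bdot (blk j) x v * y 0 j) / bdot (blk j) y y).
Proof.
apply/rowP => j; rewrite !mxE /bdot !big_distrl /= -sumrB big_distrl /=.
rewrite [RHS]big_mkcond /=; apply: eq_bigr => i _; rewrite mxE.
case: eqP => [->|_]; last by rewrite mulr0.
by rewrite -/(bdot (blk j) y y); ring.
Qed.

Lemma skew_of_tangent y v : (forall b, bdot b y y != 0) -> tangent y v ->
  y *m skew_of y v = v.
Proof.
move=> gy tv; apply/rowP => j; rewrite mulmx_skew_of mxE tv mul0r subr0.
by rewrite mulrAC divff // mul1r.
Qed.

(** Obtained from [metric_tangent] on the fields z K and z H, differentiated along v. *)
Lemma metric_derive K H y v : blockskew K -> blockskew H -> C y -> generic Phi y ->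
  \sum_b (a b y * (\sum_(i | blk i == b)
      (linfield K i y * dlinfield H i y v + dlinfield K i y v * linfield H i y))
    + 'D_v (a b) y * (\sum_(i | blk i == b) linfield K i y * linfield H i y)) =
  \sum_b c b * (bdot b (y *m K) (v *m H) + bdot b (v *m K) (y *m H)).
Proof.
move=> sK sH Cy gy.
have D1 b := is_derive_mul (differentiable_is_derive v (slope_differentiable b Cy gy))
  (is_derive_bigsum (index_enum _) (fun i => blk i == b)
    (fun i => is_derive_mul (is_derive_linfield K i v Cy) (is_derive_linfield H i v Cy))).
have D2 b := is_derive_mul (is_derive_const y v (c b))
  (is_derive_bigsum (index_enum _) (fun i => blk i == b)
    (fun i => is_derive_mul (is_derive_mulmx K y v i) (is_derive_mulmx H y v i))).
have S1 := is_derive_bigsum (index_enum _) xpredT D1.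
have S2 := is_derive_bigsum (index_enum _) xpredT D2.
rewrite (is_derive_unique generic_open (conj Cy gy) _ S1 S2).
  by apply: eq_bigr => b _; rewrite mul0r addr0 big_split.
move=> z [Cz gz]; have := metric_tangent (z *m H) Cz gz (tangent_blockskew z sK).
move=> E; apply: etrans E; apply: eq_bigr => b _; congr (_ * _).
by apply: eq_bigr => i _; rewrite !jacE.
Qed.

(** The fields z K and x_e commute, so the radial derivative of D_(z K) Z is the derivative along z
    K of D_(x_e) Z = n_b Z. The term q_b Z, coming from the derivative of n_b, is radial and will
    disappear against tangent vectors. *)
Lemma dlinfield_radial e K y : blockskew K -> C y -> generic Phi y ->
  exists q : bool -> R, forall i, dlinfield K i y (bproj e y) =
    radial_rate Phi e (blk i) y * linfield K i y + q (blk i) * Z i y.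
Proof.
move=> sK Cy gy; have tK := tangent_blockskew y sK.
have alg (p q r s t : R) : t != 0 -> p * q + r * s = t * (p / t * q + r / t * s).
  by move=> t0; field.
pose M := projmx e.
pose nu b z := \sum_(j | blk j == b) Z j z * linfield M j z.
have Dnu b := is_derive_bigsum (index_enum _) (fun j => blk j == b)
  (fun j => is_derive_mul (differentiable_is_derive (y *m K) (Phic_differentiable j Cy))
              (is_derive_linfield M j (y *m K) Cy)).
pose dnu b := \sum_(j | blk j == b) (Z j y * dlinfield M j y (y *m K)
   + 'D_(y *m K) (Z j) y * linfield M j y).
exists (fun b => dnu b / f b y) => i.
have nuE z : C z -> nu (blk i) z = bdot (blk i) (Phi z) ('D_(bproj e z) Phi z).
  move=> Cz; apply: eq_bigr => j _; rewrite jacE //.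
  by rewrite /linfield mulmx_projmx.
have eqU z : (C `&` [set y | generic Phi y]) z ->
    f (blk i) z * linfield M i z = nu (blk i) z * Z i z.
  move=> [Cz gz]; rewrite /linfield mulmx_projmx radial_jac // nuE //.
  by have [_ fz] := gz (blk i); rewrite /radial_rate mulrA [f _ _ * _]mulrC divfK.
have := is_derive_unique generic_open (conj Cy gy) eqU
  (is_derive_mul (is_derive_radius (blk i) (y *m K) Cy) (is_derive_linfield M i (y *m K) Cy))
  (is_derive_mul (Dnu (blk i)) (differentiable_is_derive (y *m K) (Phic_differentiable i Cy))).
rewrite (tangent_jac Cy gy tK) mulr0 mul0r addr0 -/(dnu _) -/(nu _ y) nuE //.
have -> : dlinfield M i y (y *m K) = dlinfield K i y (bproj e y).
  rewrite /dlinfield second_deriv_sym // mulmx_projmx; congr (_ + 'D_ _ _ _).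
  by rewrite mulmx_projmx bproj_mulmx.
have [_ fy] := gy (blk i); move=> E; apply: (mulfI fy); apply: (etrans E); exact: alg.
Qed.

(** The equation behind G_b: [metric_derive] along x_e for fields extending v and w. On the right
    each field contributes its part in the block [e] once, hence the factor 2. *)
Lemma radial_metric e y v w : C y -> generic Phi y -> tangent y v -> tangent y w ->
  \sum_b ('D_(bproj e y) (a b) y + 2 * a b y * radial_rate Phi e b y)
    * bdot b ('D_v Phi y) ('D_w Phi y) = 2 * c e * bdot e v w.
Proof.
move=> Cy gy tv tw; have gy1 b : bdot b y y != 0 by have [] := gy b.
have sK := skew_ofP y v; have sH := skew_ofP y w.
have := skew_of_tangent gy1 tv; have := skew_of_tangent gy1 tw.
move: (skew_of y v) (skew_of y w) sK sH => K H sK sH yH yK.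
have := metric_derive (bproj e y) sK sH Cy gy.
rewrite -!bproj_mulmx // yK yH => E.
transitivity (\sum_b c b * (bdot b v (bproj e w) + bdot b (bproj e v) w)); last first.
  rewrite big_bool /= !bdot_projr !bdot_projl.
  by case: e {E}; rewrite /= ?addr0 ?mulr0 ?addr0 ?add0r; ring.
apply: etrans E; apply: eq_bigr => b _.
have [qK XK] := dlinfield_radial e sK Cy gy.
have [qH XH] := dlinfield_radial e sH Cy gy.
have Y : \sum_(i | blk i == b) linfield K i y * linfield H i y =
    bdot b ('D_v Phi y) ('D_w Phi y).
  by apply: eq_bigr => i _; rewrite !jacE // /linfield yK yH.
have -> : \sum_(i | blk i == b) (linfield K i y * dlinfield H i y (bproj e y)
    + dlinfield K i y (bproj e y) * linfield H i y) =
    2 * radial_rate Phi e b y * \sum_(i | blk i == b) linfield K i y * linfield H i y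
    + qH b * bdot b ('D_v Phi y) (Phi y) + qK b * bdot b ('D_w Phi y) (Phi y).
  rewrite /bdot !big_distrr -!big_split /=; apply: eq_bigr => i /eqP ib.
  by rewrite XK XH ib !jacE // /linfield yK yH -/(Z i y); ring.
rewrite Y ![bdot b _ (Phi y)]bdotC !(tangent_jac Cy gy) // !mulr0 !addr0.
by ring.
Qed.

(** Koszul's formula on an orbit: the derivative of g(K, H) along K, minus half that of g(K, K)
    along H, minus g(K, [K, H]). The slopes are constant in all these directions. *)
Lemma geodesic_metric K H y : blockskew K -> blockskew H -> C y -> generic Phi y ->
  \sum_b a b y * (\sum_(i | blk i == b) dlinfield K i y (y *m K) * linfield H i y) =
  \sum_b c b * bdot b (y *m K *m K) (y *m H).
Proof.
move=> sK sH Cy gy; have tK := tangent_blockskew y sK; have tH := tangent_blockskew y sH.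
have E1 := metric_derive (y *m K) sK sH Cy gy.
have E2 := metric_derive (y *m H) sK sK Cy gy.
have E3 := metric_tangent (y *m (K *m H - H *m K)) Cy gy tK.
(* The symmetric second-order parts cancel and leave the derivative along the commutator. *)
have lin i : dlinfield H i y (y *m K) - dlinfield K i y (y *m H) =
    ('D_(y *m (K *m H - H *m K)) Phi y) 0 i.
  rewrite /dlinfield [second_deriv i y (y *m K) _]second_deriv_sym // mulmxBr !mulmxA jacE // -(scaleN1r (y *m H *m K)) derive_add ?derive_scale;
    try exact: Phic_differentiable.
  ring.
pose T1 b := \sum_(i | blk i == b) dlinfield K i y (y *m K) * linfield H i y.
pose T2 b := \sum_(i | blk i == b) linfield K i y * dlinfield H i y (y *m K).
pose T3 b := \sum_(i | blk i == b) linfield K i y * dlinfield K i y (y *m H).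
have {}E1 : \sum_b a b y * (T2 b + T1 b) =
    \sum_b c b * (bdot b (y *m K) (y *m K *m H) + bdot b (y *m K *m K) (y *m H)).
  apply: etrans E1; apply: eq_bigr => b _.
  by rewrite (tangent_slope b Cy gy tK) mul0r addr0 big_split.
have {}E2 : \sum_b a b y * T3 b = \sum_b c b * bdot b (y *m K) (y *m H *m K).
  have two : (2 : R) != 0 by rewrite pnatr_eq0.
  apply: (mulfI two); rewrite !big_distrr /=.
  transitivity (\sum_b c b * (bdot b (y *m K) (y *m H *m K) + bdot b (y *m H *m K) (y *m K))).
    apply: etrans E2; apply: eq_bigr => b _.
    rewrite (tangent_slope b Cy gy tH) mul0r addr0 mulrCA; congr (_ * _).
    rewrite /T3 big_distrr /=; apply: eq_bigr => i _; ring.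
  by apply: eq_bigr => b _; rewrite [bdot b (y *m H *m K) _]bdotC; ring.
have {}E3 : \sum_b a b y * (T2 b - T3 b) =
    \sum_b c b * (bdot b (y *m K) (y *m K *m H) - bdot b (y *m K) (y *m H *m K)).
  transitivity (\sum_b a b y * bdot b ('D_(y *m K) Phi y) ('D_(y *m (K *m H - H *m K)) Phi y)).
    apply: eq_bigr => b _; congr (_ * _); rewrite /T2 /T3 -sumrB; apply: eq_bigr => i _.
    by rewrite -mulrBr lin; congr (_ * _); rewrite (jacE _ _ Cy).
  rewrite E3; apply: eq_bigr => b _; congr (_ * _).
  by rewrite mulmxBr !mulmxA -scaleN1r bdotDr bdotZr mulN1r.
have -> : \sum_b a b y * T1 b = \sum_b a b y * (T2 b + T1 b) - \sum_b a b y * T3 b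
    - \sum_b a b y * (T2 b - T3 b).
  by rewrite -!sumrB; apply: eq_bigr => b _; ring.
by rewrite E1 E2 E3 -!sumrB; apply: eq_bigr => b _; ring.
Qed.

(** * Geodesics of the orbits *)

Definition rich b := exists i j : 'I_(k + m), [/\ i != j, blk i = b & blk j = b].

Lemma exists_block_tangent b y : rich b ->
  exists2 v, bproj b v = v & bdot b y v = 0 /\ bdot b v v != 0.
Proof.
move=> [i [j [ij ib jb]]].
have bdotE l u : blk l = b -> bdot b u (ebase R l) = u 0 l.
  move=> lb; rewrite /bdot (bigD1 l) ?lb //= coord_delta eqxx mulr1.
  by rewrite big1 ?addr0 // => q /andP[_ ql]; rewrite coord_delta (negbTE ql) mulr0.
have projE l : blk l = b -> bproj b (ebase R l) = ebase R l.
  move=> lb; apply/rowP => q; rewrite mxE coord_delta; case: eqP => // qb.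
  by case: eqP => // ql; case: qb; rewrite ql.
(* The rotation of y in the plane (i, j); if it is zero, then y_i = 0 and e_i itself is orthogonal
   to y. *)
pose v1 := y 0 i *: ebase R j - y 0 j *: ebase R i.
have [v0|v0] := eqVneq (bdot b v1 v1) 0; last first.
  exists v1; last split => //.
    apply/rowP => q; rewrite mxE; case: eqP => // /eqP qb; rewrite !mxE /=.
    have -> : (q == j) = false by apply/negbTE; apply: contraNneq qb => ->; rewrite jb.
    have -> : (q == i) = false by apply/negbTE; apply: contraNneq qb => ->; rewrite ib.
    by rewrite !mulr0 subrr.
  by rewrite /v1 -scaleNr bdotDr !bdotZr !bdotE // mulNr mulrC subrr.
have yi : y 0 i = 0.
  have := bdot_eq0 v0 jb; rewrite /v1 !mxE !eqxx eq_sym (negbTE ij) /=.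
  by rewrite mulr1 mulr0 subr0.
exists (ebase R i); first exact: projE.
by rewrite !bdotE // coord_delta eqxx oner_eq0.
Qed.

Lemma block_tangent b x v : bproj b v = v -> bdot b x v = 0 -> tangent x v.
Proof.
move=> vb xv e; have [<-//|be] := eqVneq b e.
by rewrite -vb bdot_projr eq_sym (negbTE be).
Qed.

(** Tested on an image tangent w = D_v Z confined to the block [b], [metric_tangent] equates a_b
    |w|^2 with the positive squared g1-length of v. *)
Lemma slope_gt0 b y : rich b -> C y -> generic Phi y -> 0 < a b y.
Proof.
move=> rb Cy gy; have [w wb [yw ww]] := exists_block_tangent (Phi y) rb.
have [v tv Jv] := tangent_jac_surj Cy gy (block_tangent wb yw).
have := metric_tangent v Cy gy tv; rewrite Jv.
rewrite (bigD1 b) //= big1 ?addr0 => [|e eb]; last first.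
  by rewrite -wb bdot_projr (negbTE eb) mulr0.
move=> E; rewrite -(pmulr_lgt0 _ (x := bdot b w w)); last by rewrite lt0r ww bdot_ge0.
rewrite E lt0r sumr_ge0 ?andbT => [|e _]; last by rewrite mulr_ge0 ?bdot_ge0 // ltW.
apply: contra ww => /eqP /metric_eq0 v0; rewrite -Jv v0 derive0.
by rewrite /bdot big1 // => i _; rewrite mxE mul0r.
Qed.

Definition lone b := forall i j : 'I_(k + m), blk i = b -> blk j = b -> i = j.

Lemma lone_tangent b x v i : lone b -> bdot b x x != 0 -> bdot b x v = 0 ->
  blk i = b -> v 0 i = 0.
Proof.
move=> lb xx xv ib.
have E u : bdot b x u = x 0 i * u 0 i.
  rewrite /bdot (bigD1 i) ?ib //= big1 ?addr0 // => j /andP[/eqP jb ji].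
  by rewrite (lb j i jb ib) eqxx in ji.
move: xx xv; rewrite !E => xx /eqP; rewrite mulf_eq0 => /orP[/eqP x0|/eqP//].
by rewrite x0 mul0r eqxx in xx.
Qed.

Section Geodesic.
Variable b : bool.
Hypotheses (rb : rich b) (lb : lone (~~ b)).

(** Since z K K is radial, [geodesic_metric] makes the acceleration X of Z orthogonal to the orbit
    tangents of the block, so X is a multiple of Z. The factor follows by differentiating <Z, D Z>_b
    = 0 once more and from a_b |D Z|^2 = c_b |z_b|^2, the other block having no tangents to
    contribute. *)
Lemma geodesic_equation K z i : blockskew K -> C z -> generic Phi z ->
  z *m K *m K = - bproj b z -> bdot b (z *m K) (z *m K) = bdot b z z -> blk i = b ->
  dlinfield K i z (z *m K) = - (c b * bdot b z z / A b z) * Z i z.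
Proof.
move=> sK Cz gz zKK zK ib.
have gz1 e : bdot e z z != 0 by have [] := gz e.
have [_ fz] := gz b; have a0 := slope_gt0 rb Cz gz.
have tK := tangent_blockskew z sK.
pose X : V := \row_i dlinfield K i z (z *m K).
have orthX w : bproj b w = w -> bdot b (Phi z) w = 0 -> bdot b X w = 0.
  move=> wb zw; have [v tv Jv] := tangent_jac_surj Cz gz (block_tangent wb zw).
  have := geodesic_metric sK (skew_ofP z v) Cz gz.
  rewrite zKK skew_of_tangent // => E.
  suff : a b z * bdot b X w = 0.
    by move/eqP; rewrite mulf_eq0 gt_eqF // => /eqP.
  transitivity (\sum_e c e * bdot e (- bproj b z) v); last first.
    rewrite big1 // => e _; rewrite -scaleN1r bdotZl bdot_projl tv.
    by case: ifP; rewrite !mulr0.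
  rewrite -E [RHS](bigD1 b) //= [X in _ = _ + X]big1 ?addr0 => [|e eb].
    congr (_ * _); apply: eq_bigr => j _; rewrite mxE /linfield skew_of_tangent //.
    by rewrite -jacE // Jv.
  rewrite big1 ?mulr0 // => j /eqP je; rewrite /linfield skew_of_tangent //.
  by rewrite -jacE // Jv -wb mxE je (negbTE eb) mulr0.
pose mu := bdot b X (Phi z) / f b z.
pose w := bproj b (X - mu *: Phi z).
have wE u : bdot b u w = bdot b u X - mu * bdot b u (Phi z).
  by rewrite /w bdot_projr eqxx -scaleNr bdotDr bdotZr mulNr.
have zw : bdot b (Phi z) w = 0.
  by rewrite wE bdotC /mu divfK // subrr.
have w0 : bdot b w w = 0.
  by rewrite wE bdotC orthX ?bproj_id // bdotC zw mulr0 subr0.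
have XE : dlinfield K i z (z *m K) = mu * Z i z.
  have := bdot_eq0 w0 ib; rewrite mxE ib eqxx !mxE => /eqP.
  by rewrite subr_eq0 => /eqP.
rewrite XE; congr (_ * _).
have Jt e : e != b -> bdot e ('D_(z *m K) Phi z) ('D_(z *m K) Phi z) = 0.
  move=> eb; have -> : e = ~~ b by move: eb; case: e; case: b.
  have [_ fz'] := gz (~~ b); rewrite /bdot big1 // => j /eqP jb.
  by rewrite (lone_tangent lb fz' (tangent_jac Cz gz tK _) jb) mul0r.
have S1 : bdot b X (Phi z) = - bdot b ('D_(z *m K) Phi z) ('D_(z *m K) Phi z).
  have D1 := is_derive_bigsum (index_enum _) (fun j => blk j == b)
    (fun j => is_derive_mul (differentiable_is_derive (z *m K) (Phic_differentiable j Cz))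
       (is_derive_linfield K j (z *m K) Cz)).
  have := is_derive_unique generic_open (conj Cz gz) _ D1 (is_derive_const z (z *m K) 0).
  have H : forall y, (C `&` [set y | generic Phi y]) y ->
      \sum_(j | blk j == b) Z j y * linfield K j y = 0.
    move=> y [Cy gy]; have := tangent_jac Cy gy (tangent_blockskew y sK) b.
    by move=> E; apply: etrans E; apply: eq_bigr => j _; rewrite jacE.
  move=> /(_ H); rewrite big_split /= => /eqP; rewrite addr_eq0 => /eqP E.
  rewrite bdotC; apply: etrans (etrans E _).
    by apply: eq_bigr => j _; rewrite mxE.
  by congr (- _); apply: eq_bigr => j _; rewrite jacE.
have S2 : a b z * bdot b ('D_(z *m K) Phi z) ('D_(z *m K) Phi z) = c b * bdot b z z.
  have := metric_tangent (z *m K) Cz gz tK.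
  rewrite (bigD1 b) //= [X in _ + X]big1 ?addr0 => [->|e eb]; last by rewrite Jt // mulr0.
  rewrite (bigD1 b) //= [X in _ + X]big1 ?addr0 => [|e eb]; first by rewrite zK.
  have -> : e = ~~ b by move: eb; case: e; case: b.
  rewrite /bdot big1 ?mulr0 // => j /eqP jb.
  by rewrite (lone_tangent lb (gz1 _) (tK _) jb) mul0r.
have A0 : A b z != 0.
  by apply/eqP => A0; move: a0; rewrite /slope A0 mul0r ltxx.
rewrite /mu S1 -S2 /slope; move: (bdot b ('D_(z *m K) Phi z) _) => q.
by move: fz A0; move: (f b z) (A b z) => p r p0 r0; field; rewrite p0 r0.
Qed.

(** The acceleration along an integral curve of z K. The function L agrees with [linfield] on C and
    is visibly differentiable, as the chain rule along a curve requires. *)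
Lemma linfield_curve K i (g : R -> V) (t : R) :
  (forall s, C (g s)) -> is_derive t (1 : R) g (g t *m K) ->
  is_derive t (1 : R) (fun s => linfield K i (g s)) (dlinfield K i (g t) (g t *m K)).
Proof.
move=> Cg Dg; pose L := \sum_(j < k + m) ((fun z : V => (z *m K) 0 j) * partial j (Z i)).
have LE z : C z -> linfield K i z = L z.
  move=> Cz; rewrite /L fct_sumE /linfield derive_linear_sum //.
  exact: Phic_differentiable.
have -> : (fun s => linfield K i (g s)) = (fun s => L (g s)).
  by apply/funext => s; rewrite LE.
have dL : differentiable L (g t).
  apply: differentiable_sum => j; apply: differentiableM.
    have -> : (fun z : V => (z *m K) 0 j) = \sum_(l < k + m) ((fun z : V => z 0 l) * cst (K l j)).
      by apply/funext => z; rewrite fct_sumE mxE.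
    apply: differentiable_sum => l; apply: differentiableM; last exact: differentiable_cst.
    exact: differentiable_coord.
  exact: (smooth_differentiable oC (smooth_partial j (Z_smooth i)) (Cg t)).
have -> : dlinfield K i (g t) (g t *m K) = 'D_(g t *m K) L (g t).
  apply: (is_derive_unique oC (Cg t) LE (is_derive_linfield K i _ (Cg t))).
  exact: differentiable_is_derive.
exact: is_derive_curve.
Qed.

(** Otherwise lambda < 1, where lambda^2 = c_b |y_b|^2 / A_b is constant on the orbit. Along a great
    circle Z_b is a harmonic oscillation of frequency lambda that must close up after time 2 pi,
    which forces cos(2 pi lambda) = 1. *)
Lemma pairing_le y : C y -> generic Phi y -> A b y <= c b * bdot b y y.
Proof.
move=> Cy gy; rewrite leNgt; apply/negP => lt_cA.
have [yy fy] := gy b; have gy1 e : bdot e y y != 0 by have [] := gy e.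
have yy0 : 0 < bdot b y y by rewrite lt0r yy bdot_ge0.
have cy0 : 0 < c b * bdot b y y by rewrite mulr_gt0.
have A0 : 0 < A b y by exact: lt_trans lt_cA.
pose lam := Num.sqrt (c b * bdot b y y / A b y).
have lam2 : lam ^+ 2 = c b * bdot b y y / A b y by rewrite sqr_sqrtr // ltW // divr_gt0.
have lam0 : 0 < lam by rewrite sqrtr_gt0 divr_gt0.
have lam1 : lam < 1.
  by rewrite -sqrtr1 ltr_sqrt // ltr_pdivrMr // mul1r.
have [v [vb yv vv]] : exists v, [/\ bproj b v = v, bdot b y v = 0 & bdot b v v = bdot b y y].
  have [v vb [yv vv]] := exists_block_tangent y rb.
  have vv0 : 0 < bdot b v v by rewrite lt0r vv bdot_ge0.
  exists (Num.sqrt (bdot b y y / bdot b v v) *: v); split.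
  - move: (Num.sqrt _) => s; rewrite -{2}vb; apply/rowP => i; rewrite !mxE.
    by case: eqP => // _; rewrite mulr0.
  - by rewrite bdotZr yv mulr0.
  - by rewrite bdotZr bdotZl mulrA -expr2 sqr_sqrtr ?divfK // ltW // divr_gt0.
have tv := block_tangent vb yv.
pose K := skew_of y v; have sK : blockskew K by exact: skew_ofP.
have yK : y *m K = v by exact: skew_of_tangent.
have pK : bproj b y *m K = v by rewrite -bproj_mulmx // yK.
have vK : v *m K = - bproj b y.
  apply/rowP => j; rewrite mulmx_skew_of !mxE; case: eqP => [->|/eqP jb].
    by rewrite bdotC yv vv mul0r sub0r mulNr mulrAC divff // mul1r.
  by rewrite -vb !bdot_projr !bdot_projl (negbTE jb) !mul0r subrr mul0r oppr0.
clearbody K.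
pose g := orbit_path b y v.
have gK s : g s *m K = - sin s *: bproj b y + cos s *: v.
  rewrite /g /orbit_path !mulmxDl -!scalemxAl yK pK vK scalerN scalerBl scale1r scaleNr.
  by rewrite [v + _]addrC subrK addrC.
have gKK s : g s *m K *m K = - bproj b (g s).
  rewrite gK mulmxDl -!scalemxAl pK vK /g /orbit_path.
  apply/rowP => j; have := congr1 (fun u : V => u 0 j) vb; rewrite !mxE.
  by case: eqP => [_ _|_ <-]; ring.
have Dg s : is_derive s (1 : R) g (g s *m K) by rewrite gK; exact: is_derive_orbit_path.
have orb s : exists A' A'', [/\ SO_mx A', SO_mx A'' & bact A' A'' y = g s].
  exact: orbit_pathP s vb yv vv yy.
have Cg s : C (g s) by have [A' [A'' [SA SB <-]]] := orb s; exact: iC.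
have ngg s e : bdot e (g s) (g s) = bdot e y y.
  by have [A' [A'' [SA SB <-]]] := orb s; rewrite bdot_bact.
have gg s : generic Phi (g s).
  move=> e; rewrite ngg; have [A' [A'' [SA SB <-]]] := orb s.
  by rewrite radius_invariant //; exact: gy.
have Ag s : A b (g s) = A b y.
  by have [A' [A'' [SA SB <-]]] := orb s; rewrite pairing_invariant.
have gKn s : bdot b (g s *m K) (g s *m K) = bdot b (g s) (g s).
  rewrite ngg gK !bdotDl !bdotDr !bdotZl !bdotZr !bdot_projl !bdot_projr eqxx vv yv bdotC yv.
  rewrite !mulr0 add0r addr0 !mulrA -mulrDl mulrNN -!expr2 addrC cos2Dsin2 mul1r //.
have g0 : g 0 = y by rewrite /g /orbit_path cos0 sin0 subrr !scale0r !addr0.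
have g2 : g (pi *+ 2) = y by rewrite /g /orbit_path cos2pi sin2pi subrr !scale0r !addr0.
have ode i : blk i = b -> Z i y = Z i y * cos (lam * (pi *+ 2))
    - linfield K i y * (sin (lam * (pi *+ 2)) / lam).
  (* A conserved quantity: the initial position recovered from position and velocity at time s. It
     is compared at s = 0 and s = 2 pi. *)
  move=> ib; pose h s := Z i (g s) * cos (lam * s) - linfield K i (g s) * (sin (lam * s) / lam).
  have Dl s : is_derive s (1 : R) (fun s : R => lam * s) lam.
    apply: is_derive_eq (is_deriveZ lam (is_derive_id s (1 : R))) _.
    by rewrite /GRing.scale /= mulr1.
  have Dc s : is_derive s (1 : R) (fun s => cos (lam * s)) (- sin (lam * s) * lam).
    exact: (is_derive1_comp (is_derive_cos _) (Dl s)).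
  have Ds s : is_derive s (1 : R) (fun s => sin (lam * s) / lam) (cos (lam * s)).
    apply: is_derive_eq (is_deriveM (is_derive1_comp (is_derive_sin _) (Dl s))
      (is_derive_cst lam^-1 s 1)) _.
    rewrite scaler0 add0r /GRing.scale /=.
    by rewrite mulrCA mulVf ?mulr1 // gt_eqF.
  have Dh s : is_derive s (1 : R) h 0.
    have DZ := is_derive_curve (Dg s) (Phic_differentiable i (Cg s)).
    have DL := linfield_curve i Cg (Dg s).
    rewrite (geodesic_equation sK (Cg s) (gg s) (gKK s) (gKn s) ib) ngg Ag -lam2 in DL.
    apply: is_derive_eq (is_deriveB (is_deriveM DZ (Dc s)) (is_deriveM DL (Ds s))) _.
    rewrite -/(linfield K i (g s)) /GRing.scale /=.
    have lam0' : lam != 0 by rewrite gt_eqF.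
    move: (Z i (g s)) (linfield K i (g s)) (cos _) (sin _) => p q r w.
    by field.
  have := is_derive_0_is_cst 0 (pi *+ 2) Dh.
  by rewrite /h g0 g2 mulr0 cos0 sin0 mul0r mulr0 subr0 mulr1.
(* Pairing with Z eliminates the velocity term, as the velocity is tangent. *)
have : f b y = f b y * cos (lam * (pi *+ 2)).
  have T := tangent_jac Cy gy (tangent_blockskew y sK) b.
  transitivity (f b y * cos (lam * (pi *+ 2))
    - bdot b (Phi y) ('D_(y *m K) Phi y) * (sin (lam * (pi *+ 2)) / lam)); last first.
    by rewrite T mul0r subr0.
  rewrite /radius2 /bdot !big_distrl /= -sumrB; apply: eq_bigr => i /eqP ib.
  rewrite jacE // -/(linfield K i y) -/(Z i y) {2}(ode i ib).
  by move: (cos _) (_ / lam) => p q; ring.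
rewrite -{1}[f b y]mulr1 => /(mulfI fy)/esym/eqP; apply/negP.
by rewrite mulrnAr cos_double_neq1 // mulr_gt0 ?pi_gt0 //= gtr_pMl ?pi_gt0.
Qed.

End Geodesic.

(** * Constancy of the slopes and linearity *)

Local Notation nrate := (radial_rate Phi).

(** This is G_b for the radial direction x_e. *)
Definition drate e b y : R := 'D_(bproj e y) (a b) y + 2 * a b y * nrate e b y.

(** An image tangent w = D_v Z confined to the block [b] is tested in [metric_tangent] and
    [radial_metric] against the images of both block parts of v. As v is nonzero, G_b is 2 a_b if v
    has a part in the block [e], and 0 if it has a part in the other. *)
Lemma drate_rich e b y : rich b -> C y -> generic Phi y ->
  exists v, [/\ v != 0, tangent y v, (2 * a b y - drate e b y) * bdot e v v = 0 &
    drate e b y * bdot (~~ e) v v = 0].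
Proof.
move=> rb Cy gy; have [w wb [yw ww]] := exists_block_tangent (Phi y) rb.
have [v tv Jv] := tangent_jac_surj Cy gy (block_tangent wb yw).
have tp e' : tangent y (bproj e' v).
  by move=> e1; rewrite bdot_projr tv; case: ifP.
have only (h : bool -> R) u : \sum_b' h b' * bdot b' w u = h b * bdot b w u.
  rewrite (bigD1 b) //= big1 ?addr0 // => b' bb'.
  by rewrite -wb bdot_projl (negbTE bb') mulr0.
have M1 e' : a b y * bdot b w ('D_(bproj e' v) Phi y) = c e' * bdot e' v v.
  have := metric_tangent (bproj e' v) Cy gy tv; rewrite Jv only => ->.
  rewrite (bigD1 e') //= big1 ?addr0 => [|b' bb']; rewrite bdot_projr ?eqxx //.
  by rewrite (negbTE bb') mulr0.
have M2 e' : drate e b y * bdot b w ('D_(bproj e' v) Phi y) =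
    2 * c e * (if e == e' then bdot e v v else 0).
  by have := radial_metric e Cy gy tv (tp e'); rewrite Jv only bdot_projr.
exists v; split => //.
- apply: contra ww => /eqP v0; rewrite -Jv v0 derive0.
  by rewrite /bdot big1 // => i _; rewrite mxE mul0r.
- have := M2 e; have := M1 e; rewrite eqxx.
  move: (bdot b w _) (drate e b y) (a b y) (bdot e v v) => q G s x E1 E2.
  apply: (mulfI (lt0r_neq0 (c_gt0 e))); rewrite mulr0.
  transitivity (s * (2 * c e * x) - G * (c e * x)); first by ring.
  by rewrite -E2 -E1; ring.
- have := M2 (~~ e); have := M1 (~~ e).
  have -> : (e == ~~ e) = false by case: (e).
  move: (bdot b w _) (drate e b y) (a b y) (bdot (~~ e) v v) => q G s x E1 E2.
  apply: (mulfI (lt0r_neq0 (c_gt0 (~~ e)))); rewrite mulr0.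
  transitivity (G * (c (~~ e) * x)); first by ring.
  by rewrite -E1 mulrCA E2 !mulr0.
Qed.

Lemma pairing_slope b y : generic Phi y -> A b y = a b y * f b y.
Proof. by move=> gy; have [_ fy] := gy b; rewrite /slope divfK. Qed.

Lemma radial_radius e b y : generic Phi y ->
  bdot b (Phi y) ('D_(bproj e y) Phi y) = nrate e b y * f b y.
Proof. by move=> gy; have [_ fy] := gy b; rewrite /radial_rate divfK. Qed.

(** Comes from differentiating sum_b a_b f_b = sum_b c_b |y_b|^2 along x_e. *)
Lemma sum_drate e y : C y -> generic Phi y ->
  \sum_b drate e b y * f b y = 2 * (c e * bdot e y y).
Proof.
move=> Cy gy; pose v := bproj e y.
have D1 b := is_derive_mul (differentiable_is_derive v (slope_differentiable b Cy gy))
  (is_derive_radius b v Cy).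
have D2 b := is_derive_mul (is_derive_const y v (c b))
  (is_derive_bigsum (index_enum _) (fun i => blk i == b)
    (fun i => is_derive_mul (is_derive_coord y v i) (is_derive_coord y v i))).
have S1 := is_derive_bigsum (index_enum _) xpredT D1.
have S2 := is_derive_bigsum (index_enum _) xpredT D2.
have U0 z : (C `&` [set y | generic Phi y]) z ->
    \sum_b a b z * f b z = \sum_b c b * bdot b z z.
  move=> [Cz gz]; rewrite -sum_pairing //; apply: eq_bigr => b _.
  by rewrite pairing_slope.
have E := is_derive_unique generic_open (conj Cy gy) U0 S1 S2.
transitivity (\sum_b (a b y * (2 * bdot b (Phi y) ('D_v Phi y)) + 'D_v (a b) y * f b y)).
  apply: eq_bigr => b _; rewrite (radial_radius e b gy) /drate -/v.
  by move: ('D_v (a b) y) (a b y) (nrate e b y) (f b y) => *; ring.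
apply: (etrans E); rewrite (bigD1 e) //= [X in _ + X]big1 ?addr0.
  rewrite mul0r addr0 mulrCA; congr (_ * _); rewrite /bdot big_distrr /=.
  by apply: eq_bigr => i ie; rewrite mxE ie; ring.
move=> b be; rewrite mul0r addr0 big1 ?mulr0 // => i /eqP ib.
by rewrite mxE ib (negbTE be) mulr0 mul0r addr0.
Qed.

(** The isometry equation [metric_slope] with both arguments equal to x_e; equated with [sum_drate],
    it gives the relation fed to [rate_of_sums]. *)
Lemma sum_radial e y : C y -> generic Phi y ->
  \sum_b f b y * nrate e b y * (drate e b y - a b y * nrate e b y) = c e * bdot e y y.
Proof.
move=> Cy gy; transitivity (\sum_b c b * bdot b (bproj e y) (bproj e y)); last first.
  rewrite (bigD1 e) //= big1 ?addr0 => [|b be]; rewrite bdot_projl bdot_projr ?eqxx //.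
  by rewrite (negbTE be) mulr0.
rewrite -(metric_slope _ _ Cy gy); apply: eq_bigr => b _.
have -> : bdot b ('D_(bproj e y) Phi y) ('D_(bproj e y) Phi y) = nrate e b y ^+ 2 * f b y.
  rewrite /radius2 /bdot big_distrr /=; apply: eq_bigr => i /eqP ib.
  by rewrite (jacE _ _ Cy) radial_jac // ib -/(Z i y); move: (nrate e b y) (Z i y) => *; ring.
rewrite radial_radius // /drate.
by move: ('D_(bproj e y) (a b) y) (a b y) (nrate e b y) (f b y) => *; ring.
Qed.

Hypothesis dichotomy : (forall b, rich b) \/ exists b, rich b /\ lone (~~ b).

(** A block with several coordinates is settled by the alternative of [drate_rich]. A
    one-dimensional block is reached from the other one through the two sum rules and
    [pairing_le]. *)
Lemma slope_bounds e b y : C y -> generic Phi y ->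
  0 < a b y /\ 0 <= drate e b y <= 2 * a b y.
Proof.
move=> Cy gy.
have pos b' : bdot b' y y != 0 by have [] := gy b'.
have f0 b' : 0 < f b' y by have [_ fy] := gy b'; rewrite lt0r fy bdot_ge0.
have cy0 b' : 0 < c b' * bdot b' y y.
  by rewrite mulr_gt0 // lt0r pos bdot_ge0.
have zero_or v : v != 0 -> bdot e v v != 0 \/ bdot (~~ e) v v != 0.
  move=> v0; have [v1|] := eqVneq (bdot e v v) 0; last by left.
  right; apply: contra v0 => /eqP v2; apply/eqP; apply: metric_eq0.
  by rewrite big_bool; case: e v1 v2 => /= -> ->; rewrite !mulr0 addr0.
have dich b' : rich b' -> drate e b' y = 2 * a b' y \/ drate e b' y = 0.
  move=> rb; have [v [v0 _ /eqP E1 /eqP E2]] := drate_rich e rb Cy gy.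
  move: E1 E2; rewrite !mulf_eq0; case: (zero_or v v0) => /negbTE ->; rewrite orbF.
    by rewrite subr_eq0 => /eqP -> _; left.
  by move=> _ /eqP ->; right.
have rich_case b' : rich b' -> 0 < a b' y /\ 0 <= drate e b' y <= 2 * a b' y.
  move=> rb; have a0 := slope_gt0 rb Cy gy; split => //.
  have a20 : 0 <= 2 * a b' y by rewrite mulr_ge0 // ltW.
  by case: (dich b' rb) => ->; rewrite ?lexx ?a20.
case: dichotomy => [rb|[b' [rb lb]]]; first exact: rich_case.
have [->|bb'] := eqVneq b b'; first exact: rich_case.
have {bb'}-> : b = ~~ b' by move: bb'; case: (b); case: (b').
have Ale := pairing_le rb lb Cy gy.
have := sum_pairing Cy; have := sum_drate e Cy gy.
have two (h : bool -> R) : \sum_i h i = h b' + h (~~ b').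
  by rewrite big_bool; case: (b'); rewrite //= addrC.
rewrite !two !pairing_slope // in Ale *.
have [v [v0 tv E1 E2]] := drate_rich e rb Cy gy.
have vt : bdot (~~ b') v v = 0.
  rewrite /bdot big1 // => i /eqP ib.
  by rewrite (lone_tangent lb (pos _) (tv _) ib) mul0r.
have vb : bdot b' v v != 0.
  apply: contra v0 => /eqP v1; apply/eqP; apply: metric_eq0.
  by rewrite two v1 vt !mulr0 addr0.
(* A tangent v has no component in the one-dimensional block, so its [b'] part is nonzero and
   decides the alternative. *)
have Gb : drate e b' y = if e == b' then 2 * a b' y else 0.
  have [ee|/negbTE ne] := eqVneq e b'.
    move/eqP: E1; rewrite {2}ee mulf_eq0 (negbTE vb) orbF subr_eq0 => /eqP.
    by rewrite ee => ->.
  have eb : ~~ e = b' by move: ne; case: (e); case: (b').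
  by move/eqP: E2; rewrite eb mulf_eq0 (negbTE vb) orbF => /eqP.
rewrite Gb; have c1 := cy0 b'; have c2 := cy0 (~~ b'); have p1 := f0 b'; have p2 := f0 (~~ b').
have -> : c e * bdot e y y = if e == b' then c b' * bdot b' y y else c (~~ b') * bdot (~~ b') y y.
  by case: eqP => [->//|/eqP ne]; have -> : e = ~~ b' by move: ne; case: (e); case: (b').
exact: slope_bounds_of_sums.
Qed.

(** The equality G_b = 2 a_b n_b from [rate_of_sums] says that the first summand of [drate]
    vanishes. *)
Lemma slope_radial0 e b y : C y -> generic Phi y -> 'D_(bproj e y) (a b) y = 0.
Proof.
move=> Cy gy.
have f0 b' : 0 < f b' y by have [_ fy] := gy b'; rewrite lt0r fy bdot_ge0.
have B b' := slope_bounds e b' Cy gy.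
have S1 := sum_drate e Cy gy; have S2 := sum_radial e Cy gy.
have := rate_of_sums f0 B (etrans S1 (congr1 _ (esym S2))) b.
rewrite /drate => /eqP; rewrite -subr_eq0 addrK => /eqP //.
Qed.

Lemma slope_derive0 b y v : C y -> generic Phi y -> 'D_v (a b) y = 0.
Proof.
move=> Cy gy; have gy1 e : bdot e y y != 0 by have [] := gy e.
have da := slope_differentiable b Cy gy.
rewrite -[v](subrK (\sum_e (bdot e y v / bdot e y y) *: bproj e y)).
rewrite derive_add // (tangent_slope b Cy gy (tangent_decomp v gy1)) add0r.
by rewrite big_bool /= derive_add // !derive_scale // !slope_radial0 // !mulr0 addr0.
Qed.

(** With constant slopes the isometry equation relates constant metrics. Its derivative shows that S
    p q r, the product of the (p, q) second derivative of Z with the r-th first derivative, is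
    antisymmetric in q, r; it is symmetric in p, q, hence zero. *)
Lemma second_derivative_generic i p q y : C y -> generic Phi y ->
  partial p (partial q (Z i)) y = 0.
Proof.
move=> Cy gy; pose H p q i := partial p (partial q (Z i)) y.
have Hs p' q' i' : H p' q' i' = H q' p' i'.
  exact: (smooth_symmetric oC p' q' (Z_smooth i') Cy).
pose S p q r := \sum_i a (blk i) y * (H p q i * partial r (Z i) y).
have Ssym p' q' r : S p' q' r = S q' p' r by apply: eq_bigr => j _; rewrite Hs.
have Santi p' q' r : S r q' p' = - S r p' q'.
  have DZ j l := differentiable_is_derive (ebase R r)
    (smooth_differentiable oC (smooth_partial l (Z_smooth j)) Cy).
  have Da (j : 'I_(k + m)) := differentiable_is_derive (ebase R r) (slope_differentiable (blk j) Cy gy).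
  have D := is_derive_bigsum (index_enum _) xpredT
    (fun j => is_derive_mul (Da j) (is_derive_mul (DZ j p') (DZ j q'))).
  have E z : (C `&` [set y | generic Phi y]) z ->
      \sum_j a (blk j) z * (partial p' (Z j) z * partial q' (Z j) z) =
      \sum_b c b * bdot b (ebase R p') (ebase R q').
    move=> [Cz gz]; rewrite -(metric_slope _ _ Cz gz) [LHS](partition_big (@blk k m) xpredT) //=.
    apply: eq_bigr => b _; rewrite slope_derive0 // mul0r addr0 /bdot big_distrr /=.
    apply: eq_bigr => j /eqP jb; rewrite jb; congr (_ * (_ * _)).
      by rewrite (jacE _ _ Cz) partialE.
    by rewrite (jacE _ _ Cz) partialE.
  have := is_derive_unique generic_open (conj Cy gy) E D (is_derive_const _ _ _).
  move=> K; apply/eqP; rewrite -addr_eq0 -[X in _ == X]K -big_split /=; apply/eqP.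
  apply: eq_bigr => j _; rewrite slope_derive0 // mul0r addr0 /H !partialE.
  by rewrite -mulrDr; congr (_ * (_ + _)); rewrite mulrC.
have S0 := sym_antisym0 Ssym (fun p' q' r => Santi r q' p').
(* A direction u with D_u Z = e_i isolates the i-th component, whose slope is positive. *)
have [u Ju] := jac_surj (ebase R i) Cy.
have : \sum_j a (blk j) y * (H p q j * ('D_u Phi y) 0 j) = 0.
  transitivity (\sum_r u 0 r * S p q r); last by rewrite big1 // => r _; rewrite S0 mulr0.
  transitivity (\sum_j \sum_r u 0 r * (a (blk j) y * (H p q j * partial r (Z j) y))).
    apply: eq_bigr => j _; rewrite (jacE _ _ Cy) derive_linear_sum; last exact: Phic_differentiable.
    rewrite !big_distrr /=; apply: eq_bigr => r _.
    by move: (a _ _) (H _ _ _) (u _ _) (partial _ _ _) => *; ring.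
  by rewrite exchange_big /=; apply: eq_bigr => r _; rewrite big_distrr.
rewrite Ju (bigD1 i) //= big1 ?addr0 => [|j ji].
  rewrite coord_delta eqxx mulr1 => /eqP; rewrite mulf_eq0.
  by have [a0 _] := slope_bounds true (blk i) Cy gy; rewrite gt_eqF // => /eqP.
by rewrite coord_delta (negbTE ji) !mulr0.
Qed.

(** No coordinate of y vanishes on a nonempty open set, and none of [Phi] does, since D Phi is onto.
    Shrinking the open set four times secures one nonzero coordinate in each block of y and of
    [Phi y]. *)
Lemma generic_dense (O : set V) : open O -> O `<=` C -> O !=set0 ->
  (exists i : 'I_(k + m), blk i = true) -> (exists i : 'I_(k + m), blk i = false) ->
  exists2 y, O y & generic Phi y.
Proof.
move=> oO OC ne [i ib] [j jb].
pose coordf l (z : V) := z 0 l.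
have coord0 l (Q : set V) : open Q -> Q `<=` C -> Q !=set0 -> exists2 z, Q z & coordf l z != 0.
  move=> oQ _ [q Qq]; apply: contrapT => H.
  have : (1 : R) = 0.
    apply: (zero_off_hyperplane (l := l) (g := fun=> 1) oQ _ _ Qq) => [z _|z Qz zl].
      exact: cst_continuous.
    by case: H; exists z.
  by move/eqP; rewrite oner_eq0.
have Z0 l (Q : set V) : open Q -> Q `<=` C -> Q !=set0 -> exists2 z, Q z & Z l z != 0.
  move=> oQ QC [q Qq]; apply: contrapT => H.
  have [u Ju] := jac_surj (ebase R l) (QC _ Qq).
  have : 'D_u (Z l) q = 0.
    apply: (is_derive_unique oQ Qq _ (differentiable_is_derive u (Phic_differentiable l (QC _ Qq)))
      (is_derive_const q u 0)) => z Qz.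
    by apply/eqP; apply: contraT => zl; case: H; exists z.
  rewrite -(jacE _ _ (QC _ Qq)) Ju coord_delta eqxx => /eqP.
  by rewrite oner_eq0.
have cc l z : C z -> {for z, continuous (coordf l)} by move=> _; exact: coord_continuous.
have cZ l z : C z -> {for z, continuous (Z l)} by exact: smooth_continuous (Z_smooth l).
have step (h : V -> R) (Q : set V) : (forall z, C z -> {for z, continuous h}) ->
    (forall Q : set V, open Q -> Q `<=` C -> Q !=set0 -> exists2 z, Q z & h z != 0) ->
    open Q -> Q `<=` C -> Q !=set0 ->
    exists Q' : set V, [/\ open Q', Q' `<=` Q, Q' !=set0 & forall z, Q' z -> h z != 0].
  move=> ch h0 oQ QC Q0; exists (Q `&` [set z | h z != 0]); split.
  - by apply: open_nonvanish => // z Qz; apply: ch; exact: QC.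
  - by move=> z [].
  - by have [z Qz hz] := h0 Q oQ QC Q0; exists z.
  - by move=> z [].
have [Q1 [q1 s1 n1 h1]] := step _ O (cc i) (coord0 i) oO OC ne.
have S1 := subset_trans s1 OC.
have [Q2 [q2 s2 n2 h2]] := step _ Q1 (cc j) (coord0 j) q1 S1 n1.
have S2 := subset_trans s2 S1.
have [Q3 [q3 s3 n3 h3]] := step _ Q2 (cZ i) (Z0 i) q2 S2 n2.
have S3 := subset_trans s3 S2.
have [Q4 [q4 s4 [y Oy] h4]] := step _ Q3 (cZ j) (Z0 j) q3 S3 n3.
exists y; first by apply/s1/s2/s3/s4.
have nb b l x : blk l = b -> x 0 l != 0 -> bdot b x x != 0.
  by move=> lb xl; apply: contra xl => /eqP xb; apply/eqP; exact: (bdot_eq0 xb).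
case; split.
- by apply: (nb _ i) => //; apply/h1/s2/s3/s4.
- by apply: (nb _ i) => //; apply/h3/s4.
- by apply: (nb _ j) => //; apply/h2/s3/s4.
- by apply: (nb _ j) => //; apply/h4.
Qed.

(** A nonzero second derivative would persist on an open set by continuity, and that set would
    contain a generic point. *)
Lemma jacmx_constant : connected C ->
  (exists i : 'I_(k + m), blk i = true) -> (exists i : 'I_(k + m), blk i = false) ->
  forall x y, C x -> C y -> jacmx Phi x = jacmx Phi y.
Proof.
move=> cC ht hf x y Cx Cy; apply/matrixP => q i; rewrite !mxE.
apply: (constant_of_partials0 oC cC (smooth_partial q (Z_smooth i))) => // p z Cz.
apply/eqP; apply: contraT => hz.
have sm : smooth_on C (partial p (partial q (Z i))).
  by do 2!apply: smooth_partial; exact: Z_smooth.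
have oO : open (C `&` [set z | partial p (partial q (Z i)) z != 0]).
  by apply: open_nonvanish => // w Cw; exact: smooth_continuous sm Cw.
have [||w [Cw hw] gw] := @generic_dense _ oO _ _ ht hf.
- by move=> w [].
- by exists z.
by move: hw => /=; rewrite second_derivative_generic // eqxx.
Qed.

End IsometryEquation.

(** * Euclidean norms from block-scalar forms, and the conclusion *)

Section Assembly.
Variables (R : realType) (k m : nat).
Local Notation V := 'rV[R]_(k + m).
Variable c : bool -> R.
Hypothesis c_gt0 : forall b, 0 < c b.

Definition blockdiag : 'M[R]_(k + m) := diag_mx (\row_i c (blk i)).

Lemma bform_blockdiag (u v : V) : bform blockdiag u v = \sum_b c b * bdot b u v.
Proof.
rewrite -sum_blocks /bform mul_mx_diag mxE; apply: eq_bigr => i _.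
by rewrite !mxE; ring.
Qed.

Lemma blockdiag_sym : symmetric_mx blockdiag.
Proof. exact: tr_diag_mx. Qed.

Lemma blockdiag_posdef : posdef blockdiag.
Proof.
move=> v v0; rewrite bform_blockdiag lt0r sumr_ge0 ?andbT => [|b _].
  by apply: contra v0 => /eqP /(metric_eq0 c_gt0) ->.
by rewrite mulr_ge0 ?bdot_ge0 // ltW.
Qed.

Lemma posdef_congruence (M B : 'M[R]_(k + m)) : B \in unitmx -> posdef M ->
  posdef (B *m M *m B^T).
Proof.
move=> uB pM v v0.
have -> : bform (B *m M *m B^T) v v = bform M (v *m B) (v *m B).
  by rewrite /bform trmx_mul !mulmxA.
apply: pM; apply: contra v0 => /eqP vB.
by rewrite -[v](mulmxK uB) vB mul0mx.
Qed.

Lemma euclidean_of_sq (F : V -> R) (S : set V) (M : 'M[R]_(k + m)) :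
  (forall x, 0 <= F x) -> symmetric_mx M -> posdef M ->
  (forall x, S x -> F x ^+ 2 = bform M x x) -> euclidean_on F S.
Proof.
move=> F0 sM pM H; exists M; split=> //; split=> // x Sx.
by rewrite -H // sqrtr_sqr ger0_norm.
Qed.

End Assembly.

(** The assumption n >= 3 rules out k = m = 1, where the group is trivial. *)
Lemma block_dichotomy (k m : nat) : (0 < k)%N -> (0 < m)%N -> (3 <= k + m)%N ->
  (forall b, @rich k m b) \/ exists b, @rich k m b /\ @lone k m (~~ b).
Proof.
move=> k0 m0 hn.
have richT : (1 < k)%N -> @rich k m true.
  move=> k1; exists (lshift m (Ordinal k0)), (lshift m (Ordinal k1)); split=> //.
have richF : (1 < m)%N -> @rich k m false.
  move=> m1; exists (rshift k (Ordinal m0)), (rshift k (Ordinal m1)); split.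
  - by rewrite -val_eqE /= eqn_add2l.
  - by rewrite /blk /= addn0 ltnn.
  - by rewrite /blk /= ltnNge leq_addr.
have [k1|k1] := ltnP 1 k; have [m1|m1] := ltnP 1 m.
- by left; case; [exact: richT|exact: richF].
- right; exists true; split; first exact: richT.
  move=> i j; rewrite /blk /= => /negbT; rewrite -leqNgt => ki /negbT; rewrite -leqNgt => kj.
  apply/val_inj => /=; apply/eqP; have := ltn_ord i; have := ltn_ord j.
  move: ki kj m1 m0; move: (nat_of_ord i) (nat_of_ord j); clear; lia.
- right; exists false; split; first exact: richF.
  move=> i j; rewrite /blk /= => ki kj.
  by apply/val_inj => /=; move: ki kj k1 k0; move: (nat_of_ord i) (nat_of_ord j); clear; lia.
- by move: hn; rewrite leqNgt ltnS (leq_add k1 m1).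
Qed.

Theorem theorem1p4 (R : realType) (k m : nat)
  (hk : (1 <= k)%N) (hm : (1 <= m)%N) (hn : (3 <= k + m)%N)
  (F1 : 'rV[R]_(k + m) -> R) (C1 : set 'rV[R]_(k + m)) :
  minkowski_norm F1 ->
  block_invariant_fun F1 ->
  conic C1 -> open C1 -> connected C1 -> C1 `<=` ~` [set 0] ->
  block_invariant_set C1 ->
  (forall y (v' : 'rV[R]_k) (v'' : 'rV[R]_m), C1 y ->
     hess_metric F1 y (row_mx v' 0) (row_mx 0 v'') = 0) ->
  euclidean_on F1 C1 /\
  (forall (F2 : 'rV[R]_(k + m) -> R) (Phi : 'rV[R]_(k + m) -> 'rV[R]_(k + m)),
     minkowski_norm F2 ->
     block_invariant_fun F2 ->
     local_hessian_isometry F1 F2 C1 Phi ->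
     maps_orbits C1 Phi ->
     (exists A : 'M[R]_(k + m), A \in unitmx /\ forall y, C1 y -> Phi y = y *m A) /\
     euclidean_on F2 (Phi @` C1)).
Proof.
move=> mF1 iF1 conC oC cC C0 iC orth.
have pos1 : forall b : bool, 0 < (1 : R) by [].
(* An empty [C1] supplies no base point for the constants c_b; the claims are then vacuous and the
   standard form serves. *)
have [C1ne|C1e] := pselect (C1 !=set0); last first.
  have vac (P : 'rV[R]_(k + m) -> Prop) : forall y, C1 y -> P y.
    by move=> y Cy; case: C1e; exists y.
  have F0 (F : 'rV[R]_(k + m) -> R) : minkowski_norm F -> forall x, 0 <= F x by case=> _ [].
  have euc (F : 'rV[R]_(k + m) -> R) (S : set 'rV[R]_(k + m)) :
      minkowski_norm F -> (forall y, ~ S y) -> euclidean_on F S.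
    move=> mF S0.
    apply: (@euclidean_of_sq R k m F S _ (F0 F mF) (@blockdiag_sym R k m (fun=> 1))
      (@blockdiag_posdef R k m (fun=> 1) pos1)).
    by move=> x Sx; case: (S0 x).
  split; first by apply: euc => // y Cy; apply: C1e; exists y.
  move=> F2 Phi mF2 iF2 _ _; split.
    by exists 1%:M; split; [exact: unitmx1|exact: vac].
  by apply: euc => // y [x Cx _]; apply: C1e; exists x.
have [c [c0 hc]] := hess_metric_constant hk hm mF1 iF1 oC cC C0 orth C1ne.
have nz y : C1 y -> y != 0 by move=> /C0 /= yn; apply/eqP.
split.
  have [_ [F0 _]] := mF1.
  apply: (@euclidean_of_sq R k m F1 C1 _ F0 (@blockdiag_sym R k m c) (blockdiag_posdef c0)) => x Cx.
  by rewrite bform_blockdiag -(hc x) // hess_metric_diag //; exact: nz.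
move=> F2 Phi mF2 iF2 [C2 [_ [_ [_ [[Psi [_ [PsiK [_ [sPhi _]]]]] [hom iso]]]]]] orb.
(* If [Phi y] were 0, homogeneity would give the value 0 at 2 y as well, against injectivity. *)
have Phi0 y : C1 y -> Phi y != 0.
  move=> Cy; apply/eqP => Py; have y0 := nz y Cy.
  have C2y : C1 (2 *: y).
    have [U E] := conC; move: Cy; rewrite E => -[u [t [Uu [t0 ->]]]].
    by exists u, (2 * t); rewrite scalerA mulr_gt0.
  have := PsiK _ C2y; rewrite hom // Py scaler0 -Py PsiK // => /eqP.
  by rewrite -subr_eq0 -{1}[y]scale1r -scalerBl scaler_eq0 (negbTE y0) orbF subr_eq0 lt_eqF ?ltr1n.
have isoc y u v : C1 y -> hess_metric F2 (Phi y) ('D_u Phi y) ('D_v Phi y) =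
    \sum_b c b * bdot b u v by move=> Cy; rewrite iso // hc.
have blkT : exists i : 'I_(k + m), blk i = true by exists (lshift m (Ordinal hk)).
have blkF : exists i : 'I_(k + m), blk i = false.
  by exists (rshift k (Ordinal hm)); rewrite /blk /= addn0 ltnn.
have [y0 Cy0] := C1ne.
pose A := jacmx Phi y0.
have uA : A \in unitmx by exact: (jacmx_unit mF2 oC c0 sPhi Phi0 isoc).
(* Euler's relation, D_y Phi at y equal to [Phi y], turns a constant Jacobian into linearity. *)
have lin y : C1 y -> Phi y = y *m A.
  move=> Cy; rewrite -(jac_euler oC sPhi hom Cy) (jac_mulmx oC sPhi) //; congr (_ *m _).
  exact: (jacmx_constant mF2 iF2 oC c0 sPhi Phi0 hom isoc orb iC (block_dichotomy hk hm hn) cC).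
split; first by exists A.
have [_ [F0 _]] := mF2; have uB : invmx A \in unitmx by rewrite unitmx_inv.
(* F2(Phi y)^2 = g1(y, y), so the form of F2 is that of F1 transported by the inverse of [A]. *)
apply: (@euclidean_of_sq R k m F2 _ _ F0 _ (posdef_congruence uB (blockdiag_posdef c0))).
  by rewrite /symmetric_mx !trmx_mul trmxK blockdiag_sym mulmxA.
move=> _ [y Cy <-]; rewrite (norm_isometry mF2 oC sPhi Phi0 hom isoc Cy) -bform_blockdiag.
by rewrite /bform !mulmxA -[in RHS]mulmxA -trmx_mul lin // mulmxK.
Qed.
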